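(* Let $M\ge 2$ be an integer, let $p_{i,j}\in[0,1]$ for $i,j\in\{0,\dots,M-1\}$ with $\sum_{i,j=0}^{M-1}p_{i,j}>M$, and let $E\subset[0,1]^2$ be the associated fractal percolation. Let $\alpha\in\mathfrak{D}=(0,\pi/2)\cup(\pi/2,\pi)$ and assume that Condition A($\alpha$) holds. Then, conditioned on $E\neq\emptyset$, almost surely $\mathrm{proj}_\alpha(E)$ contains an interval.
   Context: **Fractal percolation.** Let $K=[0,1]^2$. For $n\ge 0$ and $\underline{i}_n=(i_1,\dots,i_n),\ \underline{j}_n=(j_1,\dots,j_n)\in\{0,\dots,M-1\}^n$ let $K_{\underline{i}_n,\underline{j}_n}$ be the closed square of side $M^{-n}$ with lower left corner $\left(\sum_{l=1}^n i_lM^{-l},\sum_{l=1}^n j_lM^{-l}\right)$ (so $K_{\emptyset,\emptyset}=K$). Random families $\mathcal{E}_n$ of pairs $(\underline{i}_n,\underline{j}_n)$ are defined inductively: $\mathcal{E}_0=\{(\emptyset,\emptyset)\}$; if $(\underline{i}_n,\underline{j}_n)\notin\mathcal{E}_n$ then $(i_1,\dots,i_n,i;j_1,\dots,j_n,j)\notin\mathcal{E}_{n+1}$ for all $i,j$; if $(\underline{i}_n,\underline{j}_n)\in\mathcal{E}_n$ then $(i_1,\dots,i_n,i;j_1,\dots,j_n,j)\in\mathcal{E}_{n+1}$ with probability $p_{i,j}$; all these events are jointly independent. Put $E_n=\bigcup_{(\underline{i}_n,\underline{j}_n)\in\mathcal{E}_n}K_{\underline{i}_n,\underline{j}_n}$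 and $E=\bigcap_{n\ge1}E_n$. **Projections.** $\mathrm{proj}_\alpha$ is the orthogonal projection of $\mathbb{R}^2$ onto the line through the origin spanned by $(\cos\alpha,\sin\alpha)$; its fibres are the lines parallel to $(-\sin\alpha,\cos\alpha)$. ''Contains an interval'' means contains a non-degenerate open interval. For $\alpha\in(0,\pi/2)$ let $\Delta_\alpha$ be the diagonal of $K$ joining $(0,0)$ and $(1,1)$; for $\alpha\in(\pi/2,\pi)$ let $\Delta_\alpha$ be the diagonal joining $(0,1)$ and $(1,0)$. $\Pi_\alpha:K\to\Delta_\alpha$ is the (generally non-orthogonal) linear projection onto $\Delta_\alpha$ along the fibres of $\mathrm{proj}_\alpha$. **The operator $F_\alpha$.** For $(i,j)\in\{0,\dots,M-1\}^2$ let $\varphi_{i,j}(x)=\frac1M x+\left(\frac iM,\frac jM\right)$, which maps $K$ onto $K_{i,j}$, and let $\psi_{\alpha,i,j}:\Pi_\alpha(K_{i,j})\to\Delta_\alpha$ be the inverse of the affine contraction $\Pi_\alpha\circ\varphi_{i,j}:\Delta_\alpha\to\Delta_\alpha$. For a function $f:\Delta_\alpha\to[0,\infty)$ vanishing at the endpoints of $\Delta_\alpha$ put $$F_\alpha f(x)=\sum_{(i,j):\,x\in\Pi_\alpha(K_{i,j})}p_{i,j}\, f(\psi_{\alpha,i,j}(x)),\qquad x\in\Delta_\alpha,$$ and let $F_\alpha^n$ be the $n$-th iterate of $F_\alpha$. **Condition A($\alpha$).** There exist non-degenerate closed intervals $I_1^\alpha,I_2^\alpha\subset\Delta_\alpha$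 and a positive integer $r_\alpha$ such that $I_1^\alpha\subset\mathrm{int}\, I_2^\alpha$, $I_2^\alpha\subset\mathrm{int}\,\Delta_\alpha$ (interiors relative to the diagonal; $\mathrm{int}\,\Delta_\alpha$ is $\Delta_\alpha$ without its endpoints), and $F_\alpha^{r_\alpha}\mathbf{1}_{I_1^\alpha}\ge 2\cdot\mathbf{1}_{I_2^\alpha}$ pointwise on $\Delta_\alpha$. *)

(* Defs.v *)
From HB Require Import structures.
From mathcomp Require Import all_boot all_order all_algebra.
From mathcomp Require Import all_classical all_reals all_analysis.
From mathcomp Require Import ring lra.

Set Implicit Arguments.
Unset Strict Implicit.
Unset Printing Implicit Defensive.

Import Order.TTheory GRing.Theory Num.Theory.
Import numFieldNormedType.Exports.

Local Open Scope classical_set_scope.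
Local Open Scope ring_scope.

Definition mutually_independent (R : realType) (d : measure_display)
    (T : measurableType d) (P : probability T R) (I : eqType)
    (A : I -> set T) : Prop :=
  forall s : seq I, uniq s ->
    P (\bigcap_(i in [set` s]) A i) = (\prod_(i <- s) P (A i))%E.

(* A pair of words ((i_1, ..., i_n), (j_1, ..., j_n)) is encoded as the word
   (i_1, j_1) ... (i_n, j_n) of pairs of digits. *)
Notation cell M := ('I_M * 'I_M)%type.

Section FractalPercolation.
Context {R : realType}.
Variable M : nat.
Implicit Types (p : 'I_M -> 'I_M -> R) (x y : R * R).

Definition unit_square : set (R * R) := `[0, 1] `*` `[0, 1].

Definition corner n (w : n.-tuple (cell M)) : R * R :=
  (\sum_(l < n) (tnth w l).1%:R * M%:R ^- l.+1,
   \sum_(l < n) (tnth w l).2%:R * M%:R ^- l.+1).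

Definition square n (w : n.-tuple (cell M)) : set (R * R) :=
  `[(corner w).1, (corner w).1 + M%:R ^- n] `*`
  `[(corner w).2, (corner w).2 + M%:R ^- n].

(* [X (w, c)] is the event that the child [c] of the square [w] is kept,
   provided that [w] itself has survived. *)
Definition percolation_choices (d : measure_display) (T : measurableType d)
    (P : probability T R) p (X : seq (cell M) * cell M -> set T) : Prop :=
  [/\ forall wc, measurable (X wc),
      forall w c, P (X (w, c)) = (p c.1 c.2)%:E
    & mutually_independent P X].

Fixpoint surviving (T : Type) (X : seq (cell M) * cell M -> set T) (t : T)
    (n : nat) : set (n.-tuple (cell M)) :=
  match n with
  | 0 => [set [tuple]]
  | m.+1 => [set v | exists w c,
      [/\ surviving X t w, X (val w, c) t & v = [tuple of rcons w c]]]
  end.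

Definition percolation_level (T : Type) (X : seq (cell M) * cell M -> set T)
    (t : T) (n : nat) : set (R * R) :=
  \bigcup_(w in @surviving T X t n) square w.

Definition fractal_percolation (T : Type)
    (X : seq (cell M) * cell M -> set T) (t : T) : set (R * R) :=
  \bigcap_(n in [set n | (1 <= n)%N]) percolation_level X t n.

Definition line_point (alpha s : R) : R * R := (s * cos alpha, s * sin alpha).

Definition orth_proj (alpha : R) x : R * R :=
  line_point alpha (x.1 * cos alpha + x.2 * sin alpha).

Definition contains_interval (alpha : R) (S : set (R * R)) : Prop :=
  exists a b : R, a < b /\ line_point alpha @` `]a, b[ `<=` S.

Definition directions : set R := `]0, pi / 2[ `|` `]pi / 2, pi[.

(* Affine parametrization of the line carrying the diagonal; the diagonal
   itself corresponds to the parameters in [0, 1]. *)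
Definition diag_point (alpha t : R) : R * R :=
  (t, if alpha < pi / 2 then t else 1 - t).

Definition diag (alpha : R) : set (R * R) := diag_point alpha @` `[0, 1].

Definition diag_interval (alpha : R) (I : set (R * R)) : Prop :=
  exists a b : R, [/\ 0 <= a, a < b, b <= 1 & I = diag_point alpha @` `[a, b]].

(* Interior relative to the line carrying the diagonal, so that the interior
   of the diagonal is the diagonal without its endpoints. *)
Definition diag_interior (alpha : R) (I : set (R * R)) : set (R * R) :=
  diag_point alpha @` (diag_point alpha @^-1` I)°.

(* The point of the diagonal on the fibre of [orth_proj alpha] through [x]
   (see [diag_projP] and [diag_proj_unique]). *)
Definition diag_proj (alpha : R) x : R * R :=
  xget x [set y | diag alpha y /\ orth_proj alpha y = orth_proj alpha x].

Definition phi (c : cell M) x : R * R :=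
  (x.1 / M%:R + c.1%:R / M%:R, x.2 / M%:R + c.2%:R / M%:R).

Definition psi (alpha : R) (c : cell M) : R * R -> R * R :=
  'pinv_(fun=> 0) (diag alpha) (diag_proj alpha \o phi c).

(* Functions on the diagonal are represented by functions on the plane; only
   the values on the diagonal are used. *)
Definition F_op p (alpha : R) (f : R * R -> R) : R * R -> R := fun x =>
  \sum_(c : cell M | x \in diag_proj alpha @` square [tuple c])
    p c.1 c.2 * f (psi alpha c x).

Definition conditionA p (alpha : R) : Prop :=
  exists (I1 I2 : set (R * R)) (r : nat),
    [/\ diag_interval alpha I1, diag_interval alpha I2 & (0 < r)%N] /\
    [/\ I1 `<=` diag_interior alpha I2,
        I2 `<=` diag_interior alpha (diag alpha)
      & forall x, diag alpha x ->
          2 * \1_I2 x <= iter r (F_op p alpha) \1_I1 x].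

End FractalPercolation.

Arguments fractal_percolation R {M T} X t.

Section Sanity.
Context {R : realType}.
Implicit Types (alpha : R) (x y : R * R).

Lemma diag_point_inj alpha : injective (diag_point alpha).
Proof. by move=> s t []. Qed.

Lemma diag_interior_itv alpha (a b : R) :
  diag_interior alpha (diag_point alpha @` `[a, b]) =
  diag_point alpha @` `]a, b[.
Proof.
rewrite /diag_interior; congr (_ @` _).
suff -> : diag_point alpha @^-1` (diag_point alpha @` `[a, b]) = `[a, b]%classic.
  by rewrite interior_itv.
apply/seteqP; split=> t /=; last by exists t.
by case=> s sab /diag_point_inj <-.
Qed.

Lemma directions_cossin alpha : directions alpha ->
  0 < sin alpha /\ (if alpha < pi / 2 then 0 < cos alpha else cos alpha < 0).
Proof.
have pi0 := pi_gt0 R.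
case=> /=; rewrite in_itv /= => /andP[h1 h2]; split.
- by apply: sin_gt0_pi; rewrite ?h1 //=; lra.
- by rewrite h2; apply: cos_gt0_pihalf; rewrite h2 andbT; lra.
- by apply: sin_gt0_pi; rewrite ?h2 ?andbT //=; lra.
- rewrite ltNge (ltW h1) /=.
  have : 0 < cos (pi - alpha) by apply: cos_gt0_pihalf; apply/andP; split; lra.
  by rewrite cosB cospi sinpi mulN1r mul0r addr0 oppr_gt0.
Qed.

Lemma proj_eqE alpha x y : orth_proj alpha x = orth_proj alpha y <->
  x.1 * cos alpha + x.2 * sin alpha = y.1 * cos alpha + y.2 * sin alpha.
Proof.
rewrite /orth_proj; split=> [|->//].
rewrite /line_point => -[] hc hs; have h := cos2Dsin2 alpha.
by rewrite -[LHS]mulr1 -[RHS]mulr1 -h !mulrDr !expr2 !mulrA hc hs.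
Qed.

Lemma diag_proj_unique alpha y z : directions alpha ->
  diag alpha y -> diag alpha z -> orth_proj alpha y = orth_proj alpha z -> y = z.
Proof.
move=> /directions_cossin[s0 c0] [s _ <-] [t _ <-] /proj_eqE /=.
rewrite /diag_point; case: ifP c0 => _ c0 h; suff -> : s = t by [].
- have /eqP : (s - t) * (cos alpha + sin alpha) = 0 by lra.
  by rewrite mulf_eq0 => /orP[/eqP|/eqP]; lra.
- have /eqP : (s - t) * (cos alpha - sin alpha) = 0 by lra.
  by rewrite mulf_eq0 => /orP[/eqP|/eqP]; lra.
Qed.

Lemma diag_projP alpha x : directions alpha -> unit_square x ->
  diag alpha (diag_proj alpha x) /\ orth_proj alpha (diag_proj alpha x) = orth_proj alpha x.
Proof.
move=> /directions_cossin[s0 c0] [/=]; rewrite !in_itv /=.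
move=> /andP[x0 x1] /andP[y0 y1].
rewrite /diag_proj; case: xgetP => [y _ //|].
move=> /(_ (diag_point alpha
  (if alpha < pi / 2 then (x.1 * cos alpha + x.2 * sin alpha) /
     (cos alpha + sin alpha)
   else (x.1 * cos alpha + (x.2 - 1) * sin alpha) /
     (cos alpha - sin alpha)))) []; split.
- exists (if alpha < pi / 2 then (x.1 * cos alpha + x.2 * sin alpha) /
     (cos alpha + sin alpha)
   else (x.1 * cos alpha + (x.2 - 1) * sin alpha) /
     (cos alpha - sin alpha)) => //=.
  rewrite in_itv /=; case: ifP c0 => _ c0.
    have cs : 0 < cos alpha + sin alpha by lra.
    by rewrite ler_pdivlMr // ler_pdivrMr //; apply/andP; split; nra.
  have cs : cos alpha - sin alpha < 0 by lra.
  by rewrite ler_ndivlMr // ler_ndivrMr //; apply/andP; split; nra.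
- apply/proj_eqE; rewrite /diag_point /=; case: ifP c0 => _ c0; field; lra.
Qed.

End Sanity.

(* Main.v *)
Require Import Defs.
From HB Require Import structures.
From mathcomp Require Import all_boot all_order all_algebra.
From mathcomp Require Import all_classical all_reals all_analysis.
From mathcomp Require Import ring lra zify.

(** Write [pi z] for the parameter on the diagonal of the point lying on the
    fibre through [z]. The map [pi] is affine, so the cell of a word [w]
    projects onto the image of [0, 1] under a similarity of ratio
    [M ^- size w], and Condition A becomes a statement on the line: an operator
    [transfer], which counts the expected number of children whose projection
    carries a given point, doubles the indicator of a core interval [[a1, b1]]
    on a larger interval [[a2, b2]] within [r] generations
    ([conditionA_transfer]).

    The first half of the proof shows that with positive probability all points
    of [[a2, b2]] are covered by kept cells of all generations ([good_event]).
    Generations are grouped into blocks in which the expected number of good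
    descendants grows by a factor 4. Suppose that after block [k] each point of
    [[a2, b2]] has a relative position in [[a2, b2]] in at least [2 ^ k] kept
    cells. The generating functional of the
    kept population is computed by iterating a thinning operator
    ([gen_functional]), which coincides with its linearization, controlled by
    Condition A, up to a quadratic error ([iter_thin_ge]); this gives a Chernoff
    bound: a given point fails to lie in the core of [2 ^ k.+1] kept cells of
    the next block with probability at most [th ^ (2 ^ k)] ([chernoff]). As the
    core is smaller than the interval, it suffices to look at a net whose size
    is only exponential in [k] ([not_crowded_net]), so the failure probabilities
    are summable and small from some block [k0] on ([double_exp_small]). The
    first [k0] blocks are dealt with by requiring that all cells of positive
    probability be kept, an event of positive probability.

    The second half is a zero-one law ([zero_one]). The probability that no kept
    cell of generation [m] sees the good event in its own subtree, and the
    probability of extinction by generation [m], are both obtained by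
    iterating the same map [m] times. In terms of complementary probabilities
    this map is increasing, strictly concave, and exceeds the identity near 0
    because the mean offspring number is larger than 1; so its iterates forget
    the initial value ([iter_surv_close]) and the two probabilities have the
    same limit. Almost surely, on survival, some kept cell therefore sees the
    good event, and compactness turns the nested coverings into points of the
    limit set whose projections fill an interval
    ([contains_interval_of_kept]).

    All events involved depend on finitely many of the independent choices, up
    to monotone limits; their probabilities are evaluated by the finite
    expectation [bexp] ([prob_config]). *)

Set Implicit Arguments.
Unset Strict Implicit.
Unset Printing Implicit Defensive.

Import Order.TTheory GRing.Theory Num.Theory.
Import numFieldNormedType.Exports.

Local Open Scope classical_set_scope.
Local Open Scope ring_scope.

(** * Finite families of independent coin tosses *)

Section BernoulliExpectation.
Context {R : realType} (I : eqType) (q : I -> R).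
Implicit Types (S : seq I) (e : I -> bool) (Phi Psi : (I -> bool) -> R).

(** [e] with the value of coordinate [i] replaced by [b]. *)
Definition setb e i b : I -> bool := fun j => if j == i then b else e j.

(** Expectation of [Phi] when the coordinates listed in [S] are tossed
    independently, coordinate [i] being true with probability [q i], and the
    other coordinates are those of [e]. *)
Fixpoint bexp S Phi e : R :=
  if S is i :: S' then
    q i * bexp S' Phi (setb e i true) + (1 - q i) * bexp S' Phi (setb e i false)
  else Phi e.

Lemma bexp_cat S1 S2 Phi e : bexp (S1 ++ S2) Phi e = bexp S1 (bexp S2 Phi) e.
Proof. by elim: S1 e => [//|i S1 IH] e /=; rewrite !IH. Qed.

(** Only the configurations that agree with [e] off [S] matter. *)
Lemma eq_bexp_off S Phi Psi e :
  (forall e', (forall i, i \notin S -> e' i = e i) -> Phi e' = Psi e') ->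
  bexp S Phi e = bexp S Psi e.
Proof.
elim: S e => [|i S IH] e H /=; first exact: H.
congr (_ * _ + _ * _); apply: IH => e' He'; apply: H => j.
  all: rewrite inE negb_or => /andP[ji jS]; rewrite He' // /setb (negbTE ji) //.
Qed.

Lemma bexpZ S Phi e (a : R) : bexp S (fun e => a * Phi e) e = a * bexp S Phi e.
Proof. by elim: S e => [//|i S IH] e /=; rewrite !IH; ring. Qed.

Lemma bexpD S Phi Psi e :
  bexp S (fun e => Phi e + Psi e) e = bexp S Phi e + bexp S Psi e.
Proof. by elim: S e => [//|i S IH] e /=; rewrite !IH; ring. Qed.

Lemma bexp_cst S e (a : R) : bexp S (fun=> a) e = a.
Proof. by elim: S e => [//|i S IH] e /=; rewrite !IH; ring. Qed.

Lemma bexp_sum (J : Type) (r : seq J) S (Phi : J -> (I -> bool) -> R) e :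
  bexp S (fun e => \sum_(j <- r) Phi j e) e = \sum_(j <- r) bexp S (Phi j) e.
Proof.
elim: r => [|j r IH].
  rewrite big_nil -[RHS](bexp_cst S e); apply: eq_bexp_off => e' _.
  by rewrite big_nil.
rewrite big_cons -IH -bexpD; apply: eq_bexp_off => e' _.
by rewrite big_cons.
Qed.

(** If [Phi] only looks at [S], the starting configuration does not matter. *)
Lemma eq_bexp_on S Phi e1 e2 :
  (forall e e', {in S, e =1 e'} -> (forall i, i \notin S -> e i = e1 i) ->
     (forall i, i \notin S -> e' i = e2 i) -> Phi e = Phi e') ->
  bexp S Phi e1 = bexp S Phi e2.
Proof.
elim: S e1 e2 => [|i S IH] e1 e2 H /=; first by apply: H => // i.
congr (_ * _ + _ * _); apply: IH => e e' ee' h1 h2; apply: H.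
1,4: move=> j; rewrite inE => /orP[/eqP ->|]; last exact: ee'.
1,2: case iS: (i \in S); first exact: ee'.
1,2: by rewrite h1 ?h2 ?iS // /setb eqxx.
all: by move=> j; rewrite inE negb_or => /andP[ji jS];
  rewrite ?(h1 _ jS) ?(h2 _ jS) /setb (negbTE ji).
Qed.

Lemma bexp_prod S (k : I -> bool -> R) e : uniq S ->
  bexp S (fun e => \prod_(i <- S) k i (e i)) e =
  \prod_(i <- S) (q i * k i true + (1 - q i) * k i false).
Proof.
elim: S e => [|i S IH] e /=; first by rewrite !big_nil.
case/andP=> iS uS.
have E b : bexp S (fun e => \prod_(j <- i :: S) k j (e j)) (setb e i b) =
    k i b * \prod_(j <- S) (q j * k j true + (1 - q j) * k j false).
  rewrite -(IH (setb e i b) uS) -bexpZ; apply: eq_bexp_off => e' He'.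
  by rewrite big_cons He' // /setb eqxx.
by rewrite !E big_cons; ring.
Qed.

Hypothesis q01 : forall i, 0 <= q i <= 1.

Lemma bexp_le S Phi Psi e : (forall e, Phi e <= Psi e) ->
  bexp S Phi e <= bexp S Psi e.
Proof.
move=> H; elim: S e => [//|i S IH] e /=.
by have /andP[q0 q1] := q01 i; apply: lerD; apply: ler_wpM2l => //; rewrite subr_ge0.
Qed.

Lemma bexp_ge0 S Phi e : (forall e, 0 <= Phi e) -> 0 <= bexp S Phi e.
Proof.
move=> H; elim: S e => [//|i S IH] e /=.
by have /andP[q0 q1] := q01 i; apply: addr_ge0; apply: mulr_ge0 => //; rewrite subr_ge0.
Qed.

End BernoulliExpectation.

(** The configuration of the events [X] observed at the sample point [t]. *)
Definition config (T : Type) (I : eqType) (X : I -> set T) (t : T) : I -> bool :=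
  fun i => `[< X i t >].

(** The predicate [Q] only looks at the coordinates in [S]. *)
Definition depends_on (I : eqType) (S : seq I) (Q : (I -> bool) -> bool) :=
  forall e e', {in S, e =1 e'} -> Q e = Q e'.

Section BernoulliProbability.
Context {R : realType} (I : eqType) (q : I -> R) (d : measure_display)
  (T : measurableType d) (P : probability T R) (X : I -> set T).
Hypothesis mX : forall i, measurable (X i).
Hypothesis PX : forall i, P (X i) = (q i)%:E.
Hypothesis indX : mutually_independent P X.

Local Notation pr A := (fine (P A)).
Local Notation config := (config X).
Implicit Types (i : I) (S : seq I) (Q : (I -> bool) -> bool).

Lemma prU A B : measurable A -> measurable B -> A `&` B = set0 ->
  pr (A `|` B) = pr A + pr B.
Proof. by move=> mA mB AB; rewrite measureU // fineD // fin_num_measure. Qed.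

Lemma prIC A B : measurable A -> measurable B ->
  pr (A `&` ~` B) = pr A - pr (A `&` B).
Proof.
move=> mA mB; rewrite -setDE measureD //.
  by rewrite fineB // fin_num_measure //; exact: measurableI.
by rewrite (le_lt_trans (probability_le1 P mA)) // ltry.
Qed.

Lemma depends_on_nil Q t : depends_on [::] Q ->
  [set t | Q (config t)] = if Q (config t) then setT else set0.
Proof.
move=> dQ; apply/seteqP; split=> u /=; rewrite (dQ (config t) (config u)) //;
  by case: ifP.
Qed.

Lemma depends_on_cons i S Q b : depends_on (i :: S) Q ->
  depends_on S (fun e => Q (setb e i b)).
Proof.
move=> dQ e e' ee'; apply: dQ => j; rewrite inE /setb.
by case: eqP => //= _; exact: ee'.
Qed.

Lemma setI_config i Q :
  [set t | Q (config t)] = (X i `&` [set t | Q (setb (config t) i true)])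
    `|` (~` X i `&` [set t | Q (setb (config t) i false)]).
Proof.
have E t : setb (config t) i `[< X i t >] = config t.
  by apply/funext => j; rewrite /setb; case: eqP => // ->.
apply/seteqP; split=> t /=.
  by rewrite -{1}(E t); case: asboolP => h; [left|right].
by rewrite -{3}(E t); case: asboolP => h [] [].
Qed.

Lemma measurable_config S Q : depends_on S Q ->
  measurable [set t | Q (config t)].
Proof.
elim: S Q => [|i S IH] Q dQ.
  have t0 : T by exact: point.
  by rewrite (depends_on_nil t0 dQ); case: ifP.
rewrite (setI_config i Q); apply: measurableU; apply: measurableI.
- exact: mX.
- exact: (IH (fun e => Q (setb e i true)) (depends_on_cons true dQ)).
- exact/measurableC/mX.
- exact: (IH (fun e => Q (setb e i false)) (depends_on_cons false dQ)).
Qed.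

Lemma bigcap_cons i (s : seq I) :
  \bigcap_(j in [set` i :: s]) X j = X i `&` \bigcap_(j in [set` s]) X j.
Proof.
rewrite -bigcap_setU1; congr bigcap; apply/seteqP; split=> j /=.
  by rewrite inE => /orP[/eqP ->|js]; [left|right].
by rewrite inE => -[->|->]; rewrite ?eqxx ?orbT.
Qed.

Lemma measurable_bigcapX (s : seq I) : measurable (\bigcap_(i in [set` s]) X i).
Proof.
elim: s => [|i s IH]; last by rewrite bigcap_cons; exact: measurableI.
by rewrite (_ : [set` [::]] = set0) ?bigcap_set0 //; apply/seteqP; split.
Qed.

(** Conditioning on an event [C] that is independent of the coordinates in [S]
    does not change the probability of what depends on [S] only. *)
Lemma prob_config_setI (C : set T) S Q e : measurable C -> uniq S ->
  (forall s, uniq s -> {subset s <= S} ->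
     pr (C `&` \bigcap_(i in [set` s]) X i) = pr C * \prod_(i <- s) q i) ->
  depends_on S Q ->
  pr (C `&` [set t | Q (config t)]) = pr C * bexp q S (fun e => (Q e)%:R) e.
Proof.
move=> mC uS indC dQ; elim: S C mC Q e uS indC dQ => [|i S IH] C mC Q e /=.
  move=> _ _ dQ.
  have t0 : T by exact: point.
  rewrite (depends_on_nil t0 dQ) (dQ e (config t0)) //.
  by case: ifP => _; rewrite ?setIT ?setI0 ?mulr1 // measure0 mulr0.
case/andP=> iS uS indC dQ.
have PCi : pr (C `&` X i) = pr C * q i.
  have := indC [:: i] isT.
  rewrite big_seq1 bigcap_cons (_ : [set` [::]] = set0) ?bigcap_set0 ?setIT; last first.
    by apply/seteqP; split.
  move=> -> // j.
  by rewrite !inE => /eqP ->; rewrite eqxx.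
have PCi' : pr (C `&` ~` X i) = pr C * (1 - q i).
  by rewrite prIC // PCi; ring.
have sub1 (s : seq I) : {subset s <= S} -> {subset i :: s <= i :: S}.
  by move=> sS j; rewrite !inE => /orP[->//|/sS ->]; rewrite orbT.
have sub2 (s : seq I) : {subset s <= S} -> {subset s <= i :: S}.
  by move=> sS j; rewrite !inE => /sS ->; rewrite orbT.
have notin (s : seq I) : {subset s <= S} -> i \notin s.
  by move=> sS; apply: contra iS; exact: sS.
have mQ b : measurable [set t | Q (setb (config t) i b)].
  exact: (@measurable_config S (fun e => Q (setb e i b)) (depends_on_cons b dQ)).
have indCX s : uniq s -> {subset s <= S} ->
    pr (C `&` X i `&` \bigcap_(i in [set` s]) X i) =
    pr (C `&` X i) * \prod_(i <- s) q i.
  move=> us sS; rewrite -setIA -bigcap_cons indC ?PCi ?big_cons ?mulrA //.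
    by rewrite /= us notin.
  exact: sub1.
rewrite (setI_config i Q) setIUr !setIA prU //; last 3 first.
- by apply: measurableI => //; exact: measurableI.
- by apply: measurableI => //; apply: measurableI => //; exact: measurableC.
- by apply/seteqP; split=> t // [[[_ ?] _] [[_ ?] _]].
have IH1 := IH _ (measurableI _ _ mC (mX i)) (fun e => Q (setb e i true)) e uS
  indCX (depends_on_cons true dQ).
have mCX' : measurable (C `&` ~` X i).
  by apply: measurableI => //; exact: measurableC.
have indCX' s : uniq s -> {subset s <= S} ->
    pr (C `&` ~` X i `&` \bigcap_(i in [set` s]) X i) =
    pr (C `&` ~` X i) * \prod_(i <- s) q i.
  move=> us sS; rewrite -setIA [~` _ `&` _]setIC setIA prIC //; last first.
    by apply: measurableI => //; exact: measurable_bigcapX.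
  rewrite -setIA [_ `&` X i]setIC setIA indCX // indC //; last exact: sub2.
  by rewrite PCi PCi'; ring.
have IH2 := IH _ mCX' (fun e => Q (setb e i false)) e uS
  indCX' (depends_on_cons false dQ).
rewrite IH1 IH2.
have E b : bexp q S (fun e => (Q (setb e i b))%:R) e =
   bexp q S (fun e => (Q e)%:R) (setb e i b) :> R.
  rewrite -(@eq_bexp_on _ _ q S _ (setb e i b) e); last first.
    move=> e1 e2 e12 h1 h2; congr (_%:R); congr (nat_of_bool _).
    apply: dQ => j; rewrite inE /setb; case: eqP => //= _; exact: e12.
  apply: eq_bexp_off => e' He'; congr (_%:R); congr (nat_of_bool (Q _)).
  by apply/funext => j; rewrite /setb; case: eqP => // ->; rewrite He' // /setb eqxx.
by rewrite !E PCi PCi'; ring.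
Qed.

(** The probability of an event depending on finitely many coordinates. *)
Lemma prob_config S Q e : uniq S -> depends_on S Q ->
  pr [set t | Q (config t)] = bexp q S (fun e => (Q e)%:R) e.
Proof.
move=> uS dQ; rewrite -[LHS]/(pr _) -[[set t | _]]setTI.
rewrite (prob_config_setI e measurableT uS) //.
  by rewrite probability_setT mul1r.
move=> s us _; rewrite setTI probability_setT mul1r indX //.
rewrite (eq_bigr (fun i => (q i)%:E)) => [|i _]; last exact: PX.
by rewrite prodEFin.
Qed.

End BernoulliProbability.

(** * The tree of words and the survival of its nodes *)

Section Words.
Context (A : finType).
Implicit Types (v w : seq A) (e : seq A * A -> bool) (n m : nat).

(** A configuration [e] tells for each word [w] and letter [c] whether the child
    [rcons w c] of [w] is kept. The word [w] itself is kept when all the choices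
    on the path from the root to [w] are positive; [kept_from e v w] only looks
    at the part of the path to [v ++ w] that lies beyond [v]. *)
Fixpoint kept_from e v w : bool :=
  if w is c :: w' then e (v, c) && kept_from e (rcons v c) w' else true.

Definition kept e w := kept_from e [::] w.

(** The configuration seen from the node [v]. *)
Definition subconf v e : seq A * A -> bool := fun i => e (v ++ i.1, i.2).

Lemma kept_from_rcons e v w c :
  kept_from e v (rcons w c) = kept_from e v w && e (v ++ w, c).
Proof.
elim: w v => [|b w IH] v /=; first by rewrite cats0 andbT.
by rewrite IH cat_rcons andbA.
Qed.

Lemma kept_rcons e w c : kept e (rcons w c) = kept e w && e (w, c).
Proof. exact: kept_from_rcons. Qed.

Lemma kept_from_subconf e v v' w :
  kept_from e (v ++ v') w = kept_from (subconf v e) v' w.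
Proof. by elim: w v' => [//|c w IH] v' /=; rewrite -IH rcons_cat. Qed.

Lemma kept_cons e c w : kept e (c :: w) = e ([::], c) && kept (subconf [:: c] e) w.
Proof. by rewrite /kept /= -(kept_from_subconf e [:: c] [::]). Qed.

Lemma kept_cat e v w : kept e (v ++ w) = kept e v && kept (subconf v e) w.
Proof.
elim: v e => [|c v IH] e.
  by rewrite (_ : subconf [::] e = e) //; apply/funext => -[].
rewrite cat_cons !kept_cons IH andbA; congr (_ && kept _ _).

Qed.

Lemma eq_kept_from e e' v w :
  (forall i, (size i.1 < size v + size w)%N -> e i = e' i) ->
  kept_from e v w = kept_from e' v w.
Proof.
elim: w v => [//|c w IH] v /= H; rewrite H /= ?addnS ?leqS ?leq_addr //.
congr (_ && _); apply: IH => i; rewrite size_rcons addSn => hi.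
by apply: H; rewrite addnS.
Qed.

(** The words of length [n], and the choices made at these words. *)
Fixpoint words n : seq (seq A) :=
  if n is m.+1 then
    [seq rcons x.1 x.2 | x <- [seq (w, c) | w <- words m, c <- index_enum A]]
  else [:: [::]].

Definition coords n : seq (seq A * A) :=
  [seq (w, c) | w <- words n, c <- index_enum A].

(** The choices that determine the first [n] generations. *)
Fixpoint coords_below n : seq (seq A * A) :=
  if n is m.+1 then coords_below m ++ coords m else [::].

Lemma mem_words n w : (w \in words n) = (size w == n).
Proof.
elim: n w => [|n IH] w; first by rewrite inE; case: w.
apply/mapP/idP => [[x /allpairsP[[v c] /= [vn _ ->]] ->]|].
  by rewrite size_rcons eqSS -IH.
case: (lastP w) => [//|v c]; rewrite size_rcons eqSS => vn.
exists (v, c) => //; apply/allpairsP; exists (v, c).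
by rewrite IH vn mem_index_enum.
Qed.

Lemma mem_coords n i : (i \in coords n) = (size i.1 == n).
Proof.
apply/allpairsP/idP => [[[v c] /= [vn _ ->]]|]; first by rewrite -mem_words.
by case: i => v c /= vn; exists (v, c); rewrite mem_words vn mem_index_enum.
Qed.

Lemma mem_coords_below n i : (i \in coords_below n) = (size i.1 < n)%N.
Proof.
by elim: n => [//|n IH]; rewrite mem_cat IH mem_coords [in RHS]ltnS [in RHS]leq_eqVlt orbC.
Qed.

Lemma words_uniq n : uniq (words n).
Proof.
elim: n => [//|n IH] /=.
rewrite map_inj_uniq => [|[v c] [v' c'] /= /rcons_inj //].
by apply: allpairs_uniq => //; [exact: index_enum_uniq|case=> ? ? []].
Qed.

Lemma coords_uniq n : uniq (coords n).
Proof.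
apply: allpairs_uniq; [exact: words_uniq|exact: index_enum_uniq|].
by case=> ? ? [].
Qed.

Lemma coords_below_uniq n : uniq (coords_below n).
Proof.
elim: n => [//|n IH] /=; rewrite cat_uniq IH coords_uniq andbT /=.
apply/hasPn => i; rewrite mem_coords mem_coords_below => /eqP ->.
by rewrite ltnn.
Qed.

Lemma eq_kept e e' n w : {in coords_below n, e =1 e'} -> (size w <= n)%N ->
  kept e w = kept e' w.
Proof.
move=> ee' wn; apply: eq_kept_from => i; rewrite add0n => iw.
by apply: ee'; rewrite mem_coords_below (leq_trans iw).
Qed.

Lemma depends_on_below n m (Q : (seq A * A -> bool) -> bool) : (n <= m)%N ->
  depends_on (coords_below n) Q -> depends_on (coords_below m) Q.
Proof.
move=> nm dQ e e' ee'; apply: dQ => i; rewrite mem_coords_below => hi.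
by apply: ee'; rewrite mem_coords_below (leq_trans hi).
Qed.

Section BigWords.
Context {R : Type} {idx : R} (op : Monoid.com_law idx).

Lemma big_coords n (F : seq A * A -> R) :
  \big[op/idx]_(i <- coords n) F i =
  \big[op/idx]_(w <- words n) \big[op/idx]_(c : A) F (w, c).
Proof. exact: big_allpairs. Qed.

Lemma big_wordsS n (F : seq A -> R) :
  \big[op/idx]_(u <- words n.+1) F u =
  \big[op/idx]_(w <- words n) \big[op/idx]_(c : A) F (rcons w c).
Proof. by rewrite big_map big_allpairs. Qed.
End BigWords.

End Words.

(** * Generating functionals of the surviving population *)

Section GeneratingFunctional.
Context {R : realType} (A : finType) (p : A -> R).
Implicit Types (h : seq A -> R).

(** [thin h w] is the probability that some child of [w] is kept and marked,
    when the marks are independent and [u] is marked with probability [h u]. *)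
Definition thin h : seq A -> R := fun w => 1 - \prod_c (1 - p c * h (rcons w c)).

(** The linearization of [thin]: expected number of kept marked children. *)
Definition mean h : seq A -> R := fun w => \sum_c p c * h (rcons w c).

(** The probability that the choice [i] is positive. *)
Definition edge_prob (i : seq A * A) := p i.2.

Lemma gen_functional_step m (Q : (seq A * A -> bool) -> bool) h e0 :
  depends_on (coords_below A m) Q ->
  bexp edge_prob (coords A m)
    (fun e => (Q e)%:R * \prod_(u <- words A m.+1 | kept e u) (1 - h u)) e0 =
  (Q e0)%:R * \prod_(w <- words A m | kept e0 w) (1 - thin h w).
Proof.
move=> dQ.
pose k (i : seq A * A) (b : bool) : R :=
  if kept e0 i.1 && b then 1 - h (rcons i.1 i.2) else 1.
have E e : (forall i, i \notin coords A m -> e i = e0 i) ->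
    (Q e)%:R * \prod_(u <- words A m.+1 | kept e u) (1 - h u) =
    (Q e0)%:R * \prod_(i <- coords A m) k i (e i).
  move=> He.
  have ee0 : {in coords_below A m, e =1 e0}.
    move=> i; rewrite mem_coords_below => hi; apply: He.
    by rewrite mem_coords ltn_eqF.
  rewrite (dQ _ _ ee0) big_mkcond big_wordsS big_coords; congr (_ * _).
  rewrite big_seq [RHS]big_seq; apply: eq_bigr => w; rewrite mem_words => /eqP wm.
  apply: eq_bigr => c _; rewrite /k /= kept_rcons.
  by rewrite (eq_kept ee0) ?wm.
rewrite (eq_bexp_off _ E) bexpZ bexp_prod ?coords_uniq // big_coords.
congr (_ * _); rewrite [RHS]big_mkcond; apply: eq_bigr => w _; rewrite /k /=.
case: ifP => _.
  rewrite /thin opprB addrC subrK; apply: eq_bigr => c _; rewrite /edge_prob /=.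
  by ring.
by rewrite big1 // => c _; rewrite /edge_prob /=; ring.
Qed.

(** The generating functional of generation [m + j], restricted to an event [Q]
    on the first [m] generations, is that of generation [m] for the iterated
    thinning of [h]. *)
Lemma gen_functional m j (Q : (seq A * A -> bool) -> bool) h e0 :
  depends_on (coords_below A m) Q ->
  bexp edge_prob (coords_below A (m + j))
    (fun e => (Q e)%:R * \prod_(u <- words A (m + j) | kept e u) (1 - h u)) e0 =
  bexp edge_prob (coords_below A m)
    (fun e => (Q e)%:R *
              \prod_(w <- words A m | kept e w) (1 - iter j thin h w)) e0.
Proof.
move=> dQ; elim: j h => [|j IH] h; first by rewrite addn0.
rewrite addnS [coords_below _ _.+1]/= bexp_cat iterSr -IH.
apply: eq_bexp_off => e _; apply: gen_functional_step.
exact: depends_on_below (leq_addr _ _) dQ.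
Qed.

End GeneratingFunctional.

Section ProductBounds.
Context {R : realDomainType}.

Lemma prod_onem_ge0 (I : Type) (r : seq I) (x : I -> R) :
  (forall i, 0 <= x i <= 1) -> 0 <= \prod_(i <- r) (1 - x i) <= 1.
Proof.
move=> x01; elim/big_rec: _ => [|i P _ /andP[P0 P1]]; first by rewrite ler01 lexx.
by have /andP[x0 x1] := x01 i; apply/andP; split; nra.
Qed.

(** Bonferroni's inequalities, up to a factor 2 in the quadratic term. *)
Lemma prod_onem_bounds (I : Type) (r : seq I) (x : I -> R) :
  (forall i, 0 <= x i <= 1) ->
  let s := \sum_(i <- r) x i in
  1 - s <= \prod_(i <- r) (1 - x i) <= 1 - s + s ^+ 2.
Proof.
move=> x01 /=; elim: r => [|i r IH]; first by rewrite !big_nil; apply/andP; split; lra.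
rewrite !big_cons; have /andP[x0 x1] := x01 i.
have : 0 <= \sum_(i <- r) x i by apply: sumr_ge0 => j _; case/andP: (x01 j).
move: IH; set s := \sum_(_ <- _) _; set P := \prod_(_ <- _) _.
by move=> /andP[IH1 IH2] s0; apply/andP; split; nra.
Qed.

End ProductBounds.

Section ThinningBounds.
Context {R : realType} (A : finType) (p : A -> R).
Hypothesis p01 : forall c, 0 <= p c <= 1.
Implicit Types (h : seq A -> R).

Lemma weight_ge0_le1 h w : (forall w, 0 <= h w <= 1) ->
  forall c, 0 <= p c * h (rcons w c) <= 1.
Proof.
move=> h01 c; have /andP[p0 p1] := p01 c; have /andP[h0 h1] := h01 (rcons w c).
by apply/andP; split; nra.
Qed.

Lemma thin_ge0_le1 h : (forall w, 0 <= h w <= 1) -> forall w, 0 <= thin p h w <= 1.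
Proof.
move=> h01 w; rewrite /thin.
have /andP[] := prod_onem_ge0 (index_enum A) (weight_ge0_le1 w h01).
by move=> *; apply/andP; split; lra.
Qed.

Lemma thin_bounds h w : (forall w, 0 <= h w <= 1) ->
  mean p h w - mean p h w ^+ 2 <= thin p h w <= mean p h w.
Proof.
move=> h01; rewrite /thin /mean.
have /andP[] := prod_onem_bounds (index_enum A) (weight_ge0_le1 w h01).
by move=> *; apply/andP; split; lra.
Qed.

Lemma mean_ge0 h w : (forall w, 0 <= h w) -> 0 <= mean p h w.
Proof. by move=> h0; apply: sumr_ge0 => c _; apply: mulr_ge0 => //; case/andP: (p01 c). Qed.

Lemma iter_thin_ge0_le1 j h :
  (forall w, 0 <= h w <= 1) -> forall w, 0 <= iter j (thin p) h w <= 1.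
Proof. by move=> h01; elim: j => [//|j IH]; exact: thin_ge0_le1. Qed.

Lemma iter_thin_le j h s : (forall w, 0 <= h w <= s) -> s <= 1 ->
  forall w, iter j (thin p) h w <= (\sum_c p c) ^+ j * s.
Proof.
move=> hs s1.
have h01 w : 0 <= h w <= 1.
  by have /andP[h0 h1] := hs w; rewrite h0 (le_trans h1).
elim: j => [|j IH] w /=; first by rewrite mul1r; case/andP: (hs w).
have /andP[_] := thin_bounds w (iter_thin_ge0_le1 j h01).
move/le_trans; apply; rewrite exprS -mulrA mulr_suml.
by apply: ler_sum => c _; apply: ler_wpM2l => //; case/andP: (p01 c).
Qed.

(** The linearization is accurate up to a quadratic error. *)
Lemma iter_thin_ge j : exists2 C : R, 0 <= C &
  forall h s, (forall w, 0 <= h w <= s) -> 0 <= s <= 1 ->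
  forall w, iter j (mean p) h w - C * s ^+ 2 <= iter j (thin p) h w.
Proof.
set B := \sum_c p c.
have B0 : 0 <= B by apply: sumr_ge0 => c _; case/andP: (p01 c).
elim: j => [|j [C C0 IH]].
  by exists 0 => // h s _ _ w /=; rewrite mul0r subr0.
exists (B * C + B ^+ j.+1 ^+ 2); first by rewrite addr_ge0 ?mulr_ge0 ?exprn_ge0.
move=> h s hs /andP[s0 s1] w /=.
have h01 v : 0 <= h v <= 1.
  by have /andP[h0 h1] := hs v; rewrite h0 (le_trans h1).
have T01 := iter_thin_ge0_le1 j h01.
have /andP[H _] := thin_bounds w T01; apply: le_trans H.
set u := mean p (iter j (thin p) h) w.
have u0 : 0 <= u by apply: mean_ge0 => v; case/andP: (T01 v).
have uB : u <= B ^+ j.+1 * s.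
  rewrite /u exprS -mulrA mulr_suml; apply: ler_sum => c _.
  by apply: ler_wpM2l; [case/andP: (p01 c)|exact: iter_thin_le].
have uL : mean p (iter j (mean p) h) w - B * (C * s ^+ 2) <= u.
  rewrite /u /mean mulr_suml -sumrB; apply: ler_sum => c _; rewrite -mulrBr.
  by apply: ler_wpM2l; [case/andP: (p01 c)|apply: IH => //; rewrite s0].
have u2 : u ^+ 2 <= B ^+ j.+1 ^+ 2 * s ^+ 2.
  by rewrite -exprMn; apply: lerXn2r => //; rewrite nnegrE // (le_trans u0).
by rewrite mulrDl -mulrA; lra.
Qed.

End ThinningBounds.

(** * Elementary estimates *)

Section CountingBounds.
Context {R : realType}.

Lemma sub_in_count (I : eqType) (r : seq I) (a b : pred I) :
  {in r, forall i, a i -> b i} -> (count a r <= count b r)%N.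
Proof.
elim: r => [//|i r IH] H /=; apply: leq_add.
  by have := H i (mem_head _ _); case: (a i) => // ->.
by apply: IH => j jr; apply: H; rewrite inE jr orbT.
Qed.

Lemma all_prod (I : Type) (r : seq I) (a : pred I) :
  (all a r)%:R = \prod_(i <- r) (a i)%:R :> R.
Proof.
elim: r => [|i r IH]; first by rewrite big_nil.
by rewrite big_cons -IH /= -natrM mulnb.
Qed.

Lemma prod_le_expr_count (I : Type) (r : seq I) (P a : pred I) (F : I -> R) (t : R) :
  0 <= t <= 1 -> (forall i, 0 <= F i <= 1) -> (forall i, a i -> F i <= t) ->
  \prod_(i <- r | P i) F i <= t ^+ count (predI P a) r.
Proof.
move=> /andP[t0 t1] F01 Ft; elim: r => [|i r IH]; first by rewrite big_nil.
rewrite big_cons /=; case: (P i) => //=; have /andP[F0 F1] := F01 i.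
have P0 : 0 <= \prod_(i <- r | P i) F i.
  by apply: prodr_ge0 => j _; case/andP: (F01 j).
case ai: (a i); rewrite /= ?add0n ?add1n ?exprS.
  by apply: ler_pM => //; exact: Ft.
by apply: le_trans IH; rewrite -[leRHS]mul1r ler_wpM2r.
Qed.

Lemma prod_indic (I : Type) (r : seq I) (P a : pred I) (t : R) :
  \prod_(i <- r | P i) (1 - t * (a i)%:R) = (1 - t) ^+ count (predI P a) r.
Proof.
elim: r => [|i r IH]; first by rewrite big_nil.
rewrite big_cons /= IH; case: (P i) => //=; case: (a i).
  by rewrite mulr1 add1n exprS.
by rewrite mulr0 subr0 mul1r.
Qed.

Lemma sum_indic (I : Type) (r : seq I) (P a : pred I) :
  \sum_(i <- r | P i) (a i)%:R = (count (predI P a) r)%:R :> R.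
Proof.
elim: r => [|i r IH]; first by rewrite big_nil.
rewrite big_cons /= IH; case: (P i) => //=; case: (a i) => /=.
  by rewrite natrD.
by rewrite add0n add0r.
Qed.

Lemma expr_small (x eps : R) : 0 <= x < 1 -> 0 < eps -> exists n, x ^+ n <= eps.
Proof.
move=> /andP[x0 x1] e0.
have /cvgrPdist_le/(_ _ e0)[n _ H] : (fun n => x ^+ n) @ \oo --> (0 : R).
  by apply: cvg_expr; rewrite ger0_norm.
exists n; have := H n (leqnn n).
by rewrite /= sub0r normrN ger0_norm // exprn_ge0.
Qed.

Lemma expn2_linear (a b : nat) :
  exists k0, forall j, (a * (k0 + j) + b <= 2 ^ (k0 + j))%N.
Proof.
pose m := (a + b + 1)%N; have m2 : (m < 2 ^ m)%N by exact: ltn_expl.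
exists (3 * m)%N; elim => [|j IH].
  rewrite addn0 mulnC expnM -[(2 ^ 3)%N]/8%N.
  have -> : (8 ^ m = 2 ^ m * 2 ^ m * 2 ^ m)%N by rewrite -!expnMn.
  have : ((m.+1) * (m.+1) * (m.+1) <= 2 ^ m * 2 ^ m * 2 ^ m)%N by rewrite !leq_mul.
  by apply: leq_trans; rewrite /m; nia.
rewrite addnS expnS; move: IH; rewrite mulnS.
have : (a <= a * (3 * m + j))%N by rewrite leq_pmulr // /m; lia.
by lia.
Qed.

(** Doubly exponential decay beats exponential growth. *)
Lemma double_exp_small (K B th : R) : 0 <= K -> 0 <= B -> 0 <= th < 1 ->
  exists k0, forall j,
    K * B ^+ (k0 + j).+1 * th ^+ (2 ^ (k0 + j)) <= 2 ^- j.+2.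
Proof.
move=> K0 B0 th01; have /andP[t0 t1] := th01.
have [a Ha] : exists a, th ^+ a <= (2 * (B + 1))^-1.
  by apply: expr_small => //; rewrite invr_gt0; lra.
have [b Hb] : exists b, th ^+ b <= (4 * (K * B + 1))^-1.
  by apply: expr_small => //; rewrite invr_gt0; have := mulr_ge0 K0 B0; lra.
have [k0 Hk] := expn2_linear a b; exists k0 => j; move: (k0 + j)%N (Hk j) (leq_addl k0 j).
move=> k kab jk.
have KB0 := mulr_ge0 K0 B0.
have h1 : K * B * th ^+ b <= 4^-1.
  apply: (le_trans (ler_wpM2l KB0 Hb)).
  by rewrite invfM mulrCA ler_piMr ?invr_ge0 // ler_pdivrMr; lra.
have h2 : B * th ^+ a <= 2^-1.
  apply: (le_trans (ler_wpM2l B0 Ha)).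
  by rewrite invfM mulrCA ler_piMr ?invr_ge0 // ler_pdivrMr; lra.
have tk : th ^+ (2 ^ k) <= th ^+ (a * k + b) by apply: ler_wiXn2l => //; exact: ltW.
have KBk : 0 <= K * B ^+ k.+1 by rewrite mulr_ge0 // exprn_ge0.
apply: (le_trans (ler_wpM2l KBk tk)).
have -> : K * B ^+ k.+1 * th ^+ (a * k + b) = (K * B * th ^+ b) * (B * th ^+ a) ^+ k.
  by rewrite exprD exprM exprMn exprS; ring.
have h3 : (B * th ^+ a) ^+ k <= 2^-1 ^+ j.
  apply: (@le_trans _ _ (2^-1 ^+ k)).
    by apply: lerXn2r => //; rewrite nnegrE ?mulr_ge0 ?exprn_ge0 ?invr_ge0.
  by apply: ler_wiXn2l => //; rewrite ?invr_ge0 // invf_le1 //; lra.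
have -> : (2 : R) ^- j.+2 = 4^-1 * 2^-1 ^+ j.
  by rewrite !exprS exprVn; field; rewrite expf_neq0.
by apply: ler_pM => //; rewrite ?mulr_ge0 ?exprn_ge0 ?mulr_ge0 ?exprn_ge0.
Qed.

Lemma finite_net (a b delta : R) : a < b -> 0 < delta ->
  exists D, forall m, (0 < m)%N -> exists s : seq R,
    [/\ (size s <= D * m)%N, {in s, forall y, a <= y <= b} &
      forall x, a <= x <= b -> exists2 y, y \in s & `|x - y| * m%:R <= delta].
Proof.
move=> ab d0; have ba : 0 < b - a by lra.
pose D := (Num.truncn ((b - a) / delta)).+1.
have HD : b - a <= delta * D%:R.
  by rewrite mulrC -ler_pdivrMr // ltW // truncnS_gt.
exists D.+1 => m m0; pose N := (D * m)%N.
have m0' : 0 < m%:R :> R by rewrite ltr0n.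
have N0 : 0 < N%:R :> R by rewrite ltr0n muln_gt0 m0.
pose y j : R := a + j%:R * ((b - a) / N%:R).
have st : 0 < (b - a) / N%:R by rewrite divr_gt0.
exists [seq y j | j <- iota 0 N.+1]; split.
- by rewrite size_map size_iota mulSn addnC -addn1 leq_add2l.
- move=> z /mapP[j]; rewrite mem_iota add0n ltnS => /= jN ->; rewrite /y.
  have jN' : j%:R <= N%:R :> R by rewrite ler_nat.
  have : j%:R * ((b - a) / N%:R) <= b - a.
    by rewrite mulrCA ler_piMr ?(ltW ba) // ler_pdivrMr // mul1r.
  have : 0 <= j%:R * ((b - a) / N%:R) by rewrite mulr_ge0 // ltW.
  by move=> *; apply/andP; split; lra.
move=> x /andP[ax xb].
pose z := (x - a) / ((b - a) / N%:R).
have z0 : 0 <= z by rewrite divr_ge0 ?(ltW st) // subr_ge0.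
have zN : z <= N%:R.
  by rewrite ler_pdivrMr // mulrCA divff ?mulr1 ?lt0r_neq0 //; lra.
have /andP[j1 j2] := truncn_itv z0.
exists (y (Num.truncn z)).
  apply: map_f; rewrite mem_iota add0n ltnS /= -(ler_nat R).
  exact: le_trans zN.
have xz : x = a + z * ((b - a) / N%:R) by rewrite /z divfK ?lt0r_neq0 //; ring.
rewrite {1}xz /y opprD addrACA subrr add0r -mulrBl normrM (gtr0_norm st).
have zj : `|z - (Num.truncn z)%:R| <= 1.
  by rewrite ger0_norm ?subr_ge0 //; move: j2; rewrite -natr1; lra.
apply: (@le_trans _ _ (1 * ((b - a) / N%:R) * m%:R)).
  by rewrite ler_wpM2r ?(ltW m0') // ler_wpM2r // ltW.
rewrite mul1r /N natrM invfM mulrA mulfVK ?lt0r_neq0 //.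
by rewrite ler_pdivrMr // ltr0n.
Qed.

End CountingBounds.

(** * The one-dimensional process seen through the projection *)

Section Position.
Context {R : realType} (A : finType) (p : A -> R) (M : nat) (sg : A -> R).
Implicit Types (w : seq A) (x y : R) (f g : R -> R).

(** The cell of [w] projects onto an interval of length [M ^- size w], the
    image of [0, 1] under a similarity; [pos w] is the inverse of this
    similarity. *)
Definition pos w x : R := foldl (fun y c => M%:R * y - sg c) x w.

Lemma pos_rcons w c x : pos (rcons w c) x = M%:R * pos w x - sg c.
Proof. exact: foldl_rcons. Qed.

Lemma pos_cat v w x : pos (v ++ w) x = pos w (pos v x).
Proof. exact: foldl_cat. Qed.

Lemma pos_sub w x y : pos w x - pos w y = (x - y) * (M ^ size w)%:R.
Proof.
elim/last_ind: w => [|w c IH]; first by rewrite mulr1.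
rewrite !pos_rcons size_rcons expnS natrM mulrCA -IH; ring.
Qed.

(** The operator [F_alpha] in the diagonal coordinate; the condition that [x]
    lies in the projection of the cell is dropped, as it is automatic when [f]
    vanishes off [0, 1]. *)
Definition transfer f : R -> R := fun x => \sum_c p c * f (M%:R * x - sg c).

Lemma iter_mean_pos n f y w :
  iter n (mean p) (fun u => f (pos u y)) w = iter n transfer f (pos w y).
Proof.
elim: n w => [//|n IH] w /=; apply: eq_bigr => c _.
by rewrite IH pos_rcons.
Qed.

Lemma iter_transferZ n a f x :
  iter n transfer (fun y => a * f y) x = a * iter n transfer f x.
Proof.
elim: n x => [//|n IH] x /=; rewrite /transfer mulr_sumr.
by apply: eq_bigr => c _; rewrite IH; ring.
Qed.

Hypothesis p01 : forall c, 0 <= p c <= 1.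

Lemma le_iter_transfer n f g x : (forall y, f y <= g y) ->
  iter n transfer f x <= iter n transfer g x.
Proof.
move=> fg; elim: n x => [//|n IH] x /=; apply: ler_sum => c _.
by apply: ler_wpM2l => //; case/andP: (p01 c).
Qed.

Lemma iter_transfer_ge0 n f x : (forall y, 0 <= f y) -> 0 <= iter n transfer f x.
Proof.
move=> f0; elim: n x => [//|n IH] x /=; apply: sumr_ge0 => c _.
by apply: mulr_ge0 => //; case/andP: (p01 c).
Qed.

End Position.

(** Boolean membership in a closed interval. *)
Definition between {R : realType} (a b x : R) : bool := a <= x <= b.

Section GoodEvent.
Context {R : realType} (A : finType) (p : A -> R) (M : nat) (sg : A -> R).
Hypothesis p01 : forall c, 0 <= p c <= 1.
Hypothesis M0 : (0 < M)%N.
Variables (a1 b1 a2 b2 : R) (r : nat).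
Hypothesis (a21 : a2 < a1) (ab1 : a1 < b1) (b12 : b1 < b2).

Notation f1 := (fun x : R => (between a1 b1 x)%:R : R).

Hypothesis growth : forall x, between a2 b2 x ->
  2 <= iter r (transfer p M sg) f1 x.

Notation conf := (seq A * A -> bool).
Implicit Types (e : conf) (Q : conf -> bool).
Notation pos := (pos M sg).

Lemma betweenW x : between a1 b1 x -> between a2 b2 x.
Proof.
move=> /andP[h1 h2]; rewrite /between (le_trans (ltW a21)) //=.
exact: le_trans h2 (ltW b12).
Qed.

Lemma iter_growth k x : between a2 b2 x ->
  2 ^+ k.+1 <= iter (k.+1 * r) (transfer p M sg) f1 x.
Proof.
elim: k x => [|k IH] x x2; first by rewrite mul1n expr1; exact: growth.
rewrite mulSnr iterD exprS.
apply: (@le_trans _ _ (iter (k.+1 * r) (transfer p M sg) (fun y => 2 * f1 y) x)).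
  by rewrite iter_transferZ ler_pM2l //; exact: IH.
apply: le_iter_transfer => // y; case: (boolP (between a1 b1 y)) => y1.
  by rewrite mulr1; apply: growth; exact: betweenW.
by rewrite mulr0; apply: iter_transfer_ge0 => // z; rewrite ler0n.
Qed.

(** Generations are grouped into blocks of length [2 * r], so that the expected
    number of descendants grows by a factor 4 per block. *)
Notation blk := (2 * r)%N.

(** The number of kept cells of the [k]-th block that carry [x] in the larger
    interval. *)
Definition crowd_at k x e : nat :=
  count (fun u => kept e u && between a2 b2 (pos u x)) (words A (k * blk)).

(** Each point of the larger interval is carried by at least [2 ^ k] kept cells
    of the [k]-th block. *)
Definition crowded k e : bool :=
  `[< forall x, between a2 b2 x -> (2 ^ k <= crowd_at k x e)%N >].

(** The point [y] lies in the core of fewer than [2 ^ k] kept cells of the [k]-th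
    block. *)
Definition sparse_at k y e : bool :=
  (count (fun u => kept e u && between a1 b1 (pos u y)) (words A (k * blk)) < 2 ^ k)%N.

Lemma eq_count_kept e e' n (a : pred (seq A)) :
  {in coords_below A n, e =1 e'} ->
  count (fun u => kept e u && a u) (words A n) =
  count (fun u => kept e' u && a u) (words A n).
Proof.
move=> ee'; apply: eq_in_count => u; rewrite mem_words => /eqP un.
by rewrite (eq_kept ee') ?un.
Qed.

Lemma depends_on_crowded k : depends_on (coords_below A (k * blk)) (crowded k).
Proof.
move=> e e' ee'; congr asbool; apply/propext; split=> H x x2.
  by rewrite /crowd_at -(eq_count_kept _ ee'); exact: H.
by rewrite /crowd_at (eq_count_kept _ ee'); exact: H.
Qed.

(** Probabilities of events on the first [n] generations; the configuration
    [fun=> false] used beyond them is irrelevant. *)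
Notation expect n := (fun Q => bexp (edge_prob p) (coords_below A n)
  (fun e => (Q e)%:R) (fun=> false)).

Lemma edge_prob01 (i : seq A * A) : 0 <= edge_prob p i <= 1.
Proof. exact: p01. Qed.

Lemma expect_extend m j Q : depends_on (coords_below A m) Q ->
  expect (m + j)%N Q = expect m Q.
Proof.
move=> dQ; have := gen_functional p j (fun=> 0) (fun=> false) dQ.
have E n : bexp (edge_prob p) (coords_below A n)
    (fun e => (Q e)%:R * \prod_(u <- words A n | kept e u) (1 - 0)) (fun=> false) =
    expect n Q.
  by apply: eq_bexp_off => e _; rewrite big1 ?mulr1 // => u _; rewrite subr0.
rewrite E => ->; rewrite -E; apply: eq_bexp_off => e _; congr (_ * _).
apply: eq_bigr => u _; congr (1 - _).
elim: j u => [//|j IH] u /=; rewrite /thin big1 ?subrr // => c _.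
by rewrite IH mulr0 subr0.
Qed.

(** Chernoff's bound, uniform in the past: when the interval is crowded after
    block [k], a given point fails to be covered often enough after the next
    block with doubly exponentially small conditional probability. *)
Lemma chernoff : exists2 th : R, 0 <= th < 1 &
  forall k y Q, between a2 b2 y ->
  depends_on (coords_below A (k * blk)) Q -> (forall e, Q e -> crowded k e) ->
  expect (k.+1 * blk)%N (fun e => Q e && sparse_at k.+1 y e) <=
  th ^+ (2 ^ k) * expect (k * blk)%N Q.
Proof.
have [C C0 HC] := iter_thin_ge p01 blk.
(* The marking probability [s] is so small that the quadratic error [C * s ^+ 2]
   is at most [s], a quarter of the main term [4 * s]. *)
have [s [s0 s4 Cs]] : exists s : R, [/\ 0 < s, s <= 4^-1 & C * s <= 1].
  exists (4 * (C + 1))^-1; split; first by rewrite invr_gt0; lra.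
    by rewrite lef_pV2 ?posrE; lra.
  by rewrite ler_pdivrMr; lra.
have Cs2 : C * s ^+ 2 <= s by rewrite expr2 mulrA ler_piMl // ltW.
have s1 : 0 < 1 - s by lra.
have s3 : 0 <= 1 - 3 * s by lra.
exists ((1 - 3 * s) / (1 - s) ^+ 2).
  rewrite divr_ge0 ?exprn_ge0 ?(ltW s1) //=.
  by rewrite ltr_pdivrMr ?exprn_gt0 // mul1r; nra.
move=> k y Q y2 dQ Qcrowd.
(* Descendants that carry [y] in their core are marked with probability [s];
   the functional below is the probability that no mark occurs. *)
pose h u := s * f1 (pos u y).
have hs u : 0 <= h u <= s.
  by rewrite /h; case: (between _ _ _); rewrite ?mulr1 ?mulr0 ?lexx (ltW s0).
have h01 u : 0 <= h u <= 1.
  by have /andP[-> h2] := hs u; rewrite (le_trans h2) //; lra.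
pose G e := (Q e)%:R * \prod_(u <- words A (k.+1 * blk)%N | kept e u) (1 - h u).
have markov e : (Q e && sparse_at k.+1 y e)%:R <= (1 - s) ^- (2 ^ k.+1) * G e.
  rewrite /G /h prod_indic; case: (Q e) => /=; last by rewrite mul0r mulr0.
  rewrite mul1r; case: (boolP (sparse_at _ _ _)) => sp; last first.
    by rewrite mulr_ge0 ?invr_ge0 ?exprn_ge0 // ltW.
  rewrite mulrC ler_pdivlMr ?exprn_gt0 // mul1r.
  by apply: ler_wiXn2l; [lra|lra|exact: ltnW].
apply: (le_trans (bexp_le edge_prob01 _ _ markov)); rewrite bexpZ.
rewrite /G mulSnr gen_functional //.
have bound e : (Q e)%:R * \prod_(w <- words A (k * blk)%N | kept e w)
      (1 - iter blk (thin p) h w) <= (1 - 3 * s) ^+ (2 ^ k) * (Q e)%:R.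
  have [/Qcrowd /asboolP/(_ _ y2) Qe|_] := boolP (Q e); last by rewrite mul0r mulr0.
  rewrite mul1r mulr1.
  (* Each of the [2 ^ k] cells carrying [y] has a mark among its descendants
     with probability at least [4 * s - C * s ^+ 2 >= 3 * s]. *)
  apply: le_trans (_ : _ <= (1 - 3 * s) ^+ crowd_at k y e) _; last first.
    by apply: ler_wiXn2l => //; lra.
  apply: prod_le_expr_count.
  - by rewrite s3 /=; lra.
  - move=> w; have /andP[] := iter_thin_ge0_le1 p01 blk h01 w.
    by move=> *; apply/andP; split; lra.
  - move=> w w2.
    have s01 : 0 <= s <= 1 by apply/andP; split; lra.
    have H1 := HC h s hs s01 w.
    have H2 : iter blk (mean p) h w = s * iter blk (transfer p M sg) f1 (pos w y).
      rewrite -iter_transferZ.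
      exact: (iter_mean_pos p M sg blk (fun z => s * f1 z) y w).
    have := ler_wpM2l (ltW s0) (iter_growth 1 w2).
    by rewrite -H2; lra.
apply: (le_trans (ler_wpM2l _ (bexp_le edge_prob01 _ _ bound))).
  by rewrite invr_ge0 exprn_ge0 // ltW.
rewrite bexpZ mulrA le_eqVlt; apply/orP; left; apply/eqP; congr (_ * _).
by rewrite expnS exprM expr_div_n mulrC.
Qed.

(** A cell whose core contains [y] contains in its larger interval the points at
    scaled distance at most [delta] from [y]; so sparseness only has to be
    ruled out on a net of mesh [delta] at the scale of the cells. *)
Lemma not_crowded_net : exists K : nat, forall k, exists s : seq R,
  [/\ (size s <= K * M ^ (k * blk))%N, {in s, forall y, between a2 b2 y} &
    forall e, ~~ crowded k e -> has (fun y => sparse_at k y e) s].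
Proof.
pose delta : R := Num.min (a1 - a2) (b2 - b1).
have d0 : 0 < delta by rewrite lt_min !subr_gt0 a21.
have a2b2 : a2 < b2 by rewrite (lt_trans a21) // (lt_trans ab1).
have [K HK] := finite_net a2b2 d0; exists K => k.
have [|s [s1 s2 s3]] := HK (M ^ (k * blk))%N; first by rewrite expn_gt0 M0.
exists s; split => // e /asboolP.
move=> /existsNP[x /not_implyP[x2 /negP]]; rewrite -ltnNge => few.
have [y ys xy] := s3 x x2; apply/hasP; exists y => //.
apply: leq_ltn_trans few; rewrite /crowd_at.
apply: sub_in_count => u; rewrite mem_words => /eqP un /andP[-> /andP[u1 u2]] /=.
move: xy; rewrite -[X in `|x - y| * X]ger0_norm ?ler0n // -normrM -un -(pos_sub M sg).
rewrite ler_distl => /andP[h1 h2].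
have [d1 d2] : delta <= a1 - a2 /\ delta <= b2 - b1 by rewrite !ge_min !lexx orbT.
by apply/andP; split; lra.
Qed.

(** All the choices of positive probability in the first [k] blocks are
    positive. *)
Definition full k e : bool :=
  all (fun i => (0 < edge_prob p i) ==> e i) (coords_below A (k * blk)).

Lemma depends_on_full k : depends_on (coords_below A (k * blk)) (full k).
Proof. by move=> e e' ee'; apply: eq_in_all => i /ee' ->. Qed.

Lemma expect_full_gt0 k : 0 < expect (k * blk)%N (full k).
Proof.
pose F (i : seq A * A) (b : bool) : R := ((0 < edge_prob p i) ==> b)%:R.
have E e : (full k e)%:R = \prod_(i <- coords_below A (k * blk)) F i (e i).
  exact: all_prod.
rewrite (eq_bexp_off _ (fun e _ => E e)) bexp_prod ?coords_below_uniq //.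
apply: prodr_gt0 => i _; rewrite /F; have /andP[q0 q1] := edge_prob01 i.
case: (ltrP 0 (edge_prob p i)) => [qp|q0'] /=; first by rewrite mulr1 mulr0 addr0.
by rewrite !mulr1 subrKC ltr01.
Qed.

(** When all choices of positive probability are positive, the population is at
    least as large as its mean. *)
Lemma mean_le_sum n e (h : seq A -> R) : (forall u, 0 <= h u) ->
  (forall i, (size i.1 < n)%N -> 0 < edge_prob p i -> e i) ->
  iter n (mean p) h [::] <= \sum_(u <- words A n | kept e u) h u.
Proof.
move=> h0; elim: n h h0 => [|n IH] h h0 He; first by rewrite big_mkcond big_seq1.
rewrite iterSr; apply: le_trans (IH (mean p h) _ _) _.
- by move=> u; apply: mean_ge0.
- by move=> i hi; apply: He; exact: ltnW.
rewrite big_mkcond [leRHS]big_mkcond big_wordsS.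
rewrite big_seq [leRHS]big_seq; apply: ler_sum => w; rewrite mem_words => /eqP wn.
case kw: (kept e w); last by apply: sumr_ge0 => c _; rewrite kept_rcons kw.
apply: ler_sum => c _; rewrite kept_rcons kw /=.
have /andP[p0 p1] := p01 c.
case: ifPn => ewc; first by rewrite ler_piMl.
have [pp|pn] := ltrP 0 (p c).
  by case/negP: ewc; apply: He => //=; rewrite wn.
by rewrite mulr_le0_ge0.
Qed.

Lemma full_crowded k e : full k e -> crowded k e.
Proof.
move=> /allP fe; apply/asboolP => x x2.
case: k fe => [|k] fe; first by rewrite /crowd_at /= x2.
have : 2 ^+ k.+1 <= (crowd_at k.+1 x e)%:R :> R.
  have := @mean_le_sum (k.+1 * blk) e (fun u => f1 (pos u x)) _ _.
  rewrite (iter_mean_pos p M sg _ (fun z => f1 z) x [::]).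
  rewrite sum_indic => H; apply: le_trans (le_trans (H _ _) _); last 3 first.
  - by move=> u; rewrite ler0n.
  - move=> i hi; have := fe i; rewrite mem_coords_below => /(_ hi)/implyP; exact.
  - rewrite ler_nat; apply: sub_in_count => u _ /= /andP[-> /=]; exact: betweenW.
  rewrite mulnA [(k.+1 * 2)%N]mulnC mul2n -addnn addSn.
  apply: le_trans (iter_growth _ x2).
  by apply: ler_weXn2l; [lra|rewrite addnS ltnS leqW // leq_addr].
by rewrite -natrX ler_nat.
Qed.

Hypothesis r0 : (0 < r)%N.

(** With positive probability, arbitrarily long kept words cover each point of
    the interval; the event is the decreasing limit of events that depend on
    finitely many coordinates. *)
Lemma good_event : exists (gam : R) (n : nat -> nat) (D : nat -> conf -> bool),
  [/\ 0 < gam, forall j, depends_on (coords_below A (n j)) (D j),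
      forall j e, D j.+1 e -> D j e,
      forall j, gam <= expect (n j) (D j) &
      forall e, (forall j, D j e) -> forall x m, between a2 b2 x ->
        exists u, [/\ (m <= size u)%N, kept e u & between a2 b2 (pos u x)]].
Proof.
have [th th01 Hth] := chernoff; have [K HK] := not_crowded_net.
have [k0 Hk0] := @double_exp_small R K%:R ((M ^ blk)%:R) th (ler0n _ _) (ler0n _ _) th01.
(* The first [k0] blocks are full, the next [j] ones are crowded. *)
pose fix D (j : nat) (e : conf) {struct j} : bool :=
  if j is i.+1 then D i e && crowded (k0 + i.+1) e else full k0 e.
pose n j := ((k0 + j) * blk)%N.
have dD j : depends_on (coords_below A (n j)) (D j).
  elim: j => [|j IH] e e' ee'; rewrite /=.
    by apply: depends_on_full; rewrite /n addn0 in ee'.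
  congr (_ && _); last exact: depends_on_crowded ee'.
  apply: IH => i; rewrite mem_coords_below => hi; apply: ee'.
  by rewrite mem_coords_below (leq_trans hi) // leq_mul2r addnS leqnSn orbT.
have Dcrowd j e : D j e -> crowded (k0 + j) e.
  by case: j => [|j] /=; [rewrite addn0; exact: full_crowded|case/andP].
pose rho := expect (n 0) (D 0).
have rho0 : 0 < rho by rewrite /rho /n addn0; exact: expect_full_gt0.
have step j : expect (n j) (D j) * (1 - 2 ^- j.+2) <= expect (n j.+1) (D j.+1).
  have [s [s1 s2 s3]] := HK (k0 + j).+1.
  have E0 : expect (n j) (D j) = expect (n j.+1) (D j).
    by rewrite /n addnS [((k0 + j).+1 * _)%N]mulSnr expect_extend //; exact: (dD j).
  have pw e : (D j e)%:R <= (D j.+1 e)%:R +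
      \sum_(y <- s) (D j e && sparse_at (k0 + j).+1 y e)%:R :> R.
    case De: (D j e) => /=; last by rewrite De add0r sumr_ge0 // => y; rewrite ler0n.
    rewrite De addnS /=; case: (boolP (crowded _ e)) => [_|/s3/hasP[y ys sp]].
      by rewrite lerDl sumr_ge0 // => y; rewrite ler0n.
    by rewrite add0r (big_rem y) //= sp lerDl sumr_ge0 // => z; rewrite ler0n.
  have := bexp_le edge_prob01 (coords_below A (n j.+1)) (fun=> false) pw.
  rewrite bexpD bexp_sum -E0.
  have bnd : \sum_(y <- s) expect (n j.+1) (fun e => D j e && sparse_at (k0 + j).+1 y e)
      <= 2 ^- j.+2 * expect (n j) (D j).
    apply: le_trans (_ : _ <= \sum_(y <- s) th ^+ (2 ^ (k0 + j)) * expect (n j) (D j)) _.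
      rewrite big_seq [leRHS]big_seq; apply: ler_sum => y ys.
      by rewrite /n addnS; apply: Hth => //; [exact: s2|exact: dD|exact: Dcrowd].
    have sz : (size s)%:R <= K%:R * (M ^ blk)%:R ^+ (k0 + j).+1 :> R.
      by rewrite -natrX -natrM ler_nat -expnM [X in expn _ X]mulnC.
    rewrite big_const_seq count_predT iter_addr_0 -[leLHS]mulr_natr mulrAC.
    apply: ler_wpM2r; first by apply: (bexp_ge0 edge_prob01) => e; rewrite ler0n.
    apply: le_trans (Hk0 j); rewrite mulrC; apply: ler_wpM2r => //.
    by apply: exprn_ge0; case/andP: th01.
  by rewrite mulrBr mulr1 [_ * 2 ^- _]mulrC; lra.
exists (rho / 2), n, D; split => //.
- by rewrite divr_gt0.
- by move=> j e /= /andP[].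
(* At most the proportion [2 ^- j.+2] is lost at step [j], hence at most one
   half in total. *)
- move=> j; have : rho * (2^-1 + 2 ^- j.+1) <= expect (n j) (D j).
    elim: j => [|j IH]; first by rewrite expr1 [X in rho * X](_ : _ = 1) ?mulr1 //; lra.
    apply: le_trans (step j).
    have p2 : 0 < (2 : R) ^- j by rewrite invr_gt0 exprn_gt0.
    have p3 : (2 : R) ^- j <= 1 by rewrite invf_le1 ?exprn_gt0 // exprn_ege1 // ler1n.
    have e1 : (2 : R) ^- j.+1 = 2 ^- j / 2 by rewrite exprSr invfM.
    have e2 : (2 : R) ^- j.+2 = 2 ^- j / 4 by rewrite 2!exprSr -mulrA invfM -natrM.
    move: IH; rewrite e1 e2 => IH.
    have h : 0 <= 1 - (2 : R) ^- j / 4 by lra.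
    have := ler_wpM2r h IH; apply: le_trans; rewrite -mulrA ler_pM2l //.
    by move: (2 ^- j) p2 p3 => z *; nra.
  apply: le_trans; rewrite ler_pM2l // lerDl invr_ge0 exprn_ge0 //.
move=> e De x m x2.
have /asboolP/(_ x x2) := Dcrowd m e (De m).
move=> H; have : (0 < crowd_at (k0 + m) x e)%N by apply: leq_trans H; rewrite expn_gt0.
rewrite -has_count => /hasP[u]; rewrite mem_words => /eqP us /andP[ku u2].
exists u; split => //; rewrite us (leq_trans (leq_addl k0 m)) // leq_pmulr //.
by rewrite muln_gt0.
Qed.

End GoodEvent.

(** * A zero-one law along the branching process *)

Section SurvivalMap.
Context {R : realType} (A : finType) (p : A -> R).
Hypothesis p01 : forall c, 0 <= p c <= 1.

(** The probability that the root has a kept child carrying a property that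
    each node has independently with probability [u]. *)
Definition surv (u : R) : R := 1 - \prod_c (1 - p c * u).

Lemma weight01 u c : 0 <= u <= 1 -> 0 <= p c * u <= 1.
Proof. by have /andP[p0 p1] := p01 c; move=> /andP[? ?]; apply/andP; split; nra. Qed.

Lemma surv_ge0_le1 u : 0 <= u <= 1 -> 0 <= surv u <= 1.
Proof.
move=> u01; rewrite /surv.
have /andP[] := prod_onem_ge0 (index_enum A) (fun c => weight01 c u01).
by move=> *; apply/andP; split; lra.
Qed.

Lemma le_surv u v : 0 <= u -> u <= v -> v <= 1 -> surv u <= surv v.
Proof.
move=> u0 uv v1; rewrite lerB // ler_prod // => c _.
have /andP[p0 p1] := p01 c; apply/andP; split; nra.
Qed.

Lemma iter_surv_ge0_le1 n u : 0 <= u <= 1 -> 0 <= iter n surv u <= 1.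
Proof. by move=> u01; elim: n => [//|n IH]; exact: surv_ge0_le1. Qed.

Lemma le_iter_surv n u v : 0 <= u -> u <= v -> v <= 1 ->
  iter n surv u <= iter n surv v.
Proof.
move=> u0 uv v1; elim: n => [//|n IH] /=.
have /andP[? _] : 0 <= iter n surv u <= 1.
  by apply: iter_surv_ge0_le1; rewrite u0 (le_trans uv).
have /andP[_ ?] : 0 <= iter n surv v <= 1.
  by apply: iter_surv_ge0_le1; rewrite v1 (le_trans u0).
exact: le_surv.
Qed.

Hypothesis p_gt1 : 1 < \sum_c p c.

(** The mean offspring number, which is the derivative of [surv] at 0, is larger
    than 1. *)
Lemma surv_ge : exists2 g0 : R, 0 < g0 <= 1 &
  forall u : R, 0 <= u <= g0 -> u <= surv u.
Proof.
have := p_gt1; set B := \sum_c p c => B1.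
have B2 : 0 < B ^+ 2 by rewrite exprn_gt0 //; lra.
exists (Num.min 1 ((B - 1) / B ^+ 2)).
  by rewrite lt_min ltr01 divr_gt0 ?subr_gt0 //= ge_min lexx.
move=> u /andP[u0]; rewrite le_min ler_pdivlMr // => /andP[u1 uB].
have u01 : 0 <= u <= 1 by rewrite u0.
have /andP[_] := prod_onem_bounds (index_enum A) (fun c => weight01 c u01).
by rewrite -mulr_suml -/B /surv; nra.
Qed.

Lemma two_positive_weights : exists a b, [/\ a != b, 0 < p a & 0 < p b].
Proof.
have pos (Q : pred A) : 0 < \sum_(c | Q c) p c -> exists2 c, Q c & 0 < p c.
  move=> s0; apply: contrapT => H; move: s0; rewrite big1 ?ltxx // => c Qc.
  apply/eqP; rewrite eq_le; have /andP[-> _] := p01 c; rewrite andbT leNgt.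
  by apply/negP => pc; apply: H; exists c.
have [|a _ pa] := pos predT; first exact: lt_trans ltr01 p_gt1.
have [|b ba pb] := pos (predC1 a).
  by move: p_gt1; rewrite (bigD1 a) //=; have /andP[_] := p01 a; lra.
by exists a, b; rewrite eq_sym.
Qed.

Lemma prod_onem_le1 (r : seq A) (Q : pred A) (q : A -> R) :
  (forall c, 0 <= q c <= 1) -> \prod_(c <- r | Q c) (1 - q c) <= 1.
Proof.
move=> q01; elim/big_rec: _ => // i x _ x1; have /andP[h0 h1] := q01 i.
by case: (lerP 0 x) => x0; nra.
Qed.

(** Convexity in [th] of [prod (1 - th * q c)], between [th = 0] and [th = 1]. *)
Lemma prod_onem_convex (r : seq A) (Q : pred A) (q : A -> R) th :
  0 <= th <= 1 -> (forall c, 0 <= q c <= 1) ->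
  \prod_(c <- r | Q c) (1 - th * q c) <= 1 - th + th * \prod_(c <- r | Q c) (1 - q c).
Proof.
move=> /andP[t0 t1] q01; elim: r => [|c r IH]; first by rewrite !big_nil; lra.
rewrite !big_cons; case: ifP => // _.
have := prod_onem_le1 r Q q01.
have /andP[q0 q1] := q01 c.
move: IH; move: (\prod_(_ <- _ | _) _) (\prod_(_ <- _ | _) _) => y x xy y1.
apply: (@le_trans _ _ ((1 - th * q c) * (1 - th + th * y))).
  by apply: ler_wpM2l => //; nra.
have : 0 <= th * q c * (1 - th) * (1 - y) by rewrite !mulr_ge0 //; lra.
by nra.
Qed.

(** [surv] is strictly concave, quantitatively. *)
Lemma surv_concave a b th v : a != b -> 0 <= th <= 1 -> 0 <= v <= 1 ->
  th * surv v + th * (1 - th) * (p a * p b * v ^+ 2) <= surv (th * v).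
Proof.
move=> ab th01 v01; rewrite /surv (bigD1 a) //= [in leRHS](bigD1 a) //=.
have q01 c := weight01 c v01.
have cvx := prod_onem_convex (index_enum A) (fun c => c != a) th01 q01.
have := cvx; rewrite (eq_bigr (fun c => 1 - p c * (th * v))); last first.
  by move=> c _; rewrite mulrCA.
have : \prod_(c | c != a) (1 - p c * v) <= 1 - p b * v.
  rewrite (bigD1 b) 1?eq_sym //= ler_piMr //.
    by have /andP[_] := q01 b; lra.
  exact: (prod_onem_le1 _ _ q01).
have /andP[] := q01 a; have /andP[] := q01 b; case/andP: th01; case/andP: v01.
move: (\prod_(_ | _) _) (\prod_(_ | _) _) => x y.
move=> v0 v1 t0 t1; rewrite expr2 (_ : p a * p b * (v * v) = p a * v * (p b * v)); last by ring.
rewrite (_ : p a * (th * v) = th * (p a * v)); last by ring.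
move: (p a * v) (p b * v) => qa qb qb0 qb1 qa0 qa1 yqb xle.
have h : (1 - th * qa) * x <= (1 - th * qa) * (1 - th + th * y).
  by apply: ler_wpM2l => //; nra.
have : 0 <= th * qa * (1 - th) * (1 - y - qb) by rewrite !mulr_ge0 //; lra.
by nra.
Qed.

(** Iterating [surv] forgets the initial value. *)
Lemma iter_surv_close g : 0 < g <= 1 -> g <= surv g -> exists2 c : R, 0 < c <= 1 &
  forall n, iter n surv 1 - iter n surv g <= (1 - c) ^+ n.
Proof.
move=> /andP[g0 g1] gs; have [a [b [ab pa pb]]] := two_positive_weights.
have /andP[_ pa1] := p01 a; have /andP[_ pb1] := p01 b.
(* The ratio [t] of the two iterates stays above [g], so concavity improves
   [1 - t] by a fixed factor [1 - c] at each step. *)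
pose c := g ^+ 3 * (p a * p b).
have c0 : 0 < c by rewrite !mulr_gt0 ?exprn_gt0.
have c1 : c <= 1.
  have h1 : g ^+ 3 <= 1 by apply: exprn_ile1 => //; exact: ltW.
  have h2 : p a * p b <= 1 by nra.
  by rewrite -[leRHS]mulr1; apply: ler_pM => //; rewrite ?exprn_ge0 ?mulr_ge0 // ltW.
exists c; first by rewrite c0.
have g01 : 0 <= g <= 1 by rewrite g1 ltW.
have u_ge n : g <= iter n surv g.
  elim: n => [//|n IH] /=; apply: (le_trans gs); apply: le_surv => //.
    exact: ltW.
  by have /andP[] := iter_surv_ge0_le1 n g01.
have inv n : (1 - (1 - c) ^+ n * (1 - g)) * iter n surv 1 <= iter n surv g.
  elim: n => [|n IH]; first by rewrite /= mul1r mulr1; lra.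
  set t := 1 - (1 - c) ^+ n * (1 - g) in IH.
  have e0 : 0 <= (1 - c) ^+ n <= 1.
    by rewrite exprn_ge0 ?exprn_ile1 //; lra.
  have t01 : g <= t <= 1 by rewrite /t; case/andP: e0 => *; apply/andP; split; nra.
  have /andP[v0 v1] : 0 <= iter n surv 1 <= 1.
    by apply: iter_surv_ge0_le1; rewrite ler01 lexx.
  have gv : g <= iter n surv 1.
    by apply: (le_trans (u_ge n)); apply: le_iter_surv => //; exact: ltW.
  have /andP[u0 u1] : 0 <= iter n surv g <= 1.
    by apply: iter_surv_ge0_le1; rewrite g1 ltW.
  have /andP[t0 t1] : 0 <= t <= 1 by case/andP: t01 => *; apply/andP; split; lra.
  have tv0 : 0 <= t * iter n surv 1 by rewrite mulr_ge0.
  rewrite !iterS; apply: le_trans (le_surv tv0 IH u1).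
  have v01 : 0 <= iter n surv 1 <= 1 by rewrite v0.
  have t01' : 0 <= t <= 1 by rewrite t0.
  apply: le_trans (surv_concave ab t01' v01).
  have /andP[s0 s1] := surv_ge0_le1 v01.
  have cle : c <= t * (p a * p b * iter n surv 1 ^+ 2).
    rewrite /c exprS -mulrA [_ * (p a * p b)]mulrC; case/andP: t01 => gt _.
    apply: ler_pM => //; [exact: ltW|by rewrite !mulr_ge0 ?exprn_ge0 // ltW|].
    apply: ler_pM => //; rewrite ?mulr_ge0 ?exprn_ge0 ?(ltW pa) ?(ltW pb) ?(ltW g0) //.
    by apply: lerXn2r => //; rewrite nnegrE // ltW.
  rewrite (_ : 1 - (1 - c) ^+ n.+1 * (1 - g) = t + c * (1 - t)); last first.
    by rewrite /t exprS; ring.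
  have h : c * surv (iter n surv 1) <= t * (p a * p b * iter n surv 1 ^+ 2).
    by apply: le_trans cle; rewrite ler_piMr // ltW.
  have t1' : 0 <= 1 - t by rewrite subr_ge0.
  have := ler_wpM2r t1' h; move: (surv (iter n surv 1)) (iter n surv 1 ^+ 2) => S V.
  by clearbody t c; lra.
move=> n.
have /andP[v0 v1] : 0 <= iter n surv 1 <= 1.
  by apply: iter_surv_ge0_le1; rewrite ler01 lexx.
have := inv n; have e0 : 0 <= (1 - c) ^+ n by rewrite exprn_ge0 //; lra.
have : (1 - c) ^+ n * (1 - g) * iter n surv 1 <= (1 - c) ^+ n.
  by rewrite -mulrA ler_piMr // mulr_ile1 //; lra.
by lra.
Qed.

End SurvivalMap.

Section IndependentBlocks.
Context {R : realType} (I J : eqType) (q : I -> R).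

(** Functions of disjoint groups of coordinates are independent. *)
Lemma bexp_flatten (l : seq J) (S : J -> seq I) (Phi : J -> (I -> bool) -> R) e :
  uniq (flatten [seq S j | j <- l]) ->
  (forall j e e', {in S j, e =1 e'} -> Phi j e = Phi j e') ->
  bexp q (flatten [seq S j | j <- l]) (fun e => \prod_(j <- l) Phi j e) e =
  \prod_(j <- l) bexp q (S j) (Phi j) e.
Proof.
move=> + dPhi; elim: l e => [|j l IH] e /=; first by rewrite !big_nil.
rewrite cat_uniq => /and3P[_ /hasPn disj ul].
rewrite bexp_cat big_cons -[RHS]mulrC -bexpZ; apply: eq_bexp_off => e' He'.
transitivity (Phi j e' * bexp q (flatten [seq S j | j <- l])
    (fun e => \prod_(j <- l) Phi j e) e').
  rewrite -bexpZ; apply: eq_bexp_off => e'' He''; rewrite big_cons; congr (_ * _).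
  by apply: dPhi => i iS; apply: He''; apply/negP => /disj; rewrite /= iS.
rewrite mulrC IH //; congr (_ * _); apply: eq_bigr => k _.
by apply: eq_bexp_on => e1 e2 e12 _ _; apply: dPhi.
Qed.

End IndependentBlocks.

Section BranchStep.
Context {R : realType} (A : finType) (p : A -> R).
Notation conf := (seq A * A -> bool).
Implicit Types (Q : conf -> bool) (e : conf).

(** [Q] holds at all kept children of the root. *)
Definition at_children Q e : bool :=
  [forall c, e ([::], c) ==> Q (subconf [:: c] e)].

(** The choices that decide whether the child [c] of the root is kept and what
    the first [n] generations of its subtree are. *)
Definition child_coords n c : seq (seq A * A) :=
  ([::], c) :: [seq (c :: i.1, i.2) | i <- coords_below A n].

Lemma mem_child_coords n c i :
  (i \in child_coords n c) = (i == ([::], c)) ||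
     (if i.1 is b :: w then (b == c) && (size w < n)%N else false).
Proof.
rewrite inE; congr orb; case: i => -[|b w] a /=.
  by apply/negP => /mapP[].
apply/mapP/andP => [[[w' a']]|[/eqP -> wn]].
  by rewrite mem_coords_below => /= h [-> -> _].
by exists (w, a); rewrite ?mem_coords_below.
Qed.

Lemma child_coords_uniq n :
  uniq (flatten [seq child_coords n c | c <- index_enum A]).
Proof.
have : uniq (index_enum A) by exact: index_enum_uniq.
elim: (index_enum A) => [//|c l IH] /= /andP[cl ul].
change (uniq (child_coords n c ++ flatten [seq child_coords n b | b <- l])).
rewrite cat_uniq IH // andbT.
have -> : uniq (child_coords n c).
  rewrite /= map_inj_uniq ?coords_below_uniq ?andbT; last first.
    by move=> [w a] [w' a'] /= [-> ->].
  by apply/negP => /mapP[].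
rewrite andTb.
apply/hasPn => i /flatten_mapP[b bl]; rewrite !mem_child_coords.
apply: contraL => /orP[/eqP ->|].
  by rewrite /= orbF; apply/eqP => -[bc]; rewrite bc bl in cl.
case: i => -[//|d w] a /= /andP[/eqP -> _].
by apply/negP => /andP[/eqP cb _]; rewrite cb bl in cl.
Qed.

Lemma depends_on_child n Q c : depends_on (coords_below A n) Q ->
  depends_on (child_coords n c) (fun e => e ([::], c) ==> Q (subconf [:: c] e)).
Proof.
move=> dQ e e' ee'; rewrite (ee' ([::], c)) ?mem_head //; congr (_ ==> _).
apply: dQ => i; rewrite mem_coords_below => hi.
by apply: ee'; rewrite mem_child_coords /= eqxx hi.
Qed.

Lemma depends_on_at_children n Q : depends_on (coords_below A n) Q ->
  depends_on (coords_below A n.+1) (at_children Q).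
Proof.
move=> dQ e e' ee'; apply: eq_forallb => c; apply: (depends_on_child dQ) => i.
rewrite mem_child_coords => hi; apply: ee'; rewrite mem_coords_below.
case/orP: hi => [/eqP -> //|]; case: i => -[//|b w] a /= /andP[_].
by rewrite ltnS.
Qed.

Lemma iter_at_childrenP n Q e :
  reflect (forall w, size w = n -> kept e w -> Q (subconf w e))
    (iter n at_children Q e).
Proof.
apply: (iffP idP).
  elim: n e => [|n IH] e /=.
    by move=> Qe [|//] _ _; rewrite (_ : subconf _ e = e) //; apply/funext => -[].
  move=> /forallP H [//|c w] [wn]; rewrite kept_cons => /andP[ec kw].
  by have /implyP/(_ ec)/IH/(_ w wn kw) := H c.
elim: n e => [|n IH] e /= H.
  by have := H [::] erefl isT; rewrite (_ : subconf _ e = e) //; apply/funext => -[].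
apply/forallP => c; apply/implyP => ec; apply: IH => w wn kw.
by apply: (H (c :: w)); rewrite /= ?wn // kept_cons ec.
Qed.

Lemma depends_on_iter_at_children n m Q : depends_on (coords_below A n) Q ->
  depends_on (coords_below A (m + n)) (iter m at_children Q).
Proof. by move=> dQ; elim: m => [//|m IH]; exact: depends_on_at_children. Qed.

Lemma bexp_subconf (L : seq (seq A * A)) Q c e :
  bexp (edge_prob p) [seq (c :: i.1, i.2) | i <- L]
    (fun e => (Q (subconf [:: c] e))%:R) e =
  bexp (edge_prob p) L (fun e => (Q e)%:R) (subconf [:: c] e).
Proof.
elim: L e => [//|i L IH] e /=; rewrite !IH.
have E b : subconf [:: c] (setb e (c :: i.1, i.2) b) = setb (subconf [:: c] e) i b.
  apply/funext => j; rewrite /subconf /setb /=; congr (if _ then _ else _).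
  by case: i j => [w a] [w' a'] /=; apply/eqP/eqP => [[-> ->]|[-> ->]].
by rewrite !E.
Qed.

Lemma bexp_at_children n Q : depends_on (coords_below A n) Q ->
  bexp (edge_prob p) (flatten [seq child_coords n c | c <- index_enum A])
    (fun e => (at_children Q e)%:R) (fun=> false) =
  \prod_c (1 - p c * (1 - bexp (edge_prob p) (coords_below A n)
                             (fun e => (Q e)%:R) (fun=> false))).
Proof.
move=> dQ; set x := bexp _ (coords_below A n) _ _.
have E e : (at_children Q e)%:R =
    \prod_c (e ([::], c) ==> Q (subconf [:: c] e))%:R :> R.
  rewrite -all_prod; congr (_%:R); congr nat_of_bool.
  apply/forallP/allP => H c; first by move=> _; exact: H.
  by apply: H; rewrite mem_index_enum.
rewrite (eq_bexp_off _ (fun e _ => E e)).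
rewrite (@bexp_flatten R _ A _ _ _
  (fun c e => (e ([::], c) ==> Q (subconf [:: c] e))%:R) _ (child_coords_uniq n)); last first.
  by move=> c e e' ee'; rewrite (depends_on_child dQ ee').
apply: eq_bigr => c _; rewrite /child_coords /=.
set L := [seq _ | i <- _].
have setL e e' : (forall i, i \notin L -> e' i = e i) -> e' ([::], c) = e ([::], c).
  by move=> H; apply: H; apply/negP => /mapP[].
have -> : bexp (edge_prob p) L (fun e => (e ([::], c) ==> Q (subconf [:: c] e))%:R)
    (setb (fun=> false) ([::], c) false) = 1 :> R.
  rewrite -[RHS](bexp_cst (edge_prob p) L (setb (fun=> false) ([::], c) false)).
  by apply: eq_bexp_off => e /setL ->; rewrite /setb eqxx.
have -> : bexp (edge_prob p) L (fun e => (e ([::], c) ==> Q (subconf [:: c] e))%:R)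
    (setb (fun=> false) ([::], c) true) = x.
  transitivity (bexp (edge_prob p) L (fun e => (Q (subconf [:: c] e))%:R)
    (setb (fun=> false) ([::], c) true)).
    by apply: eq_bexp_off => e /setL ->; rewrite /setb eqxx.
  rewrite bexp_subconf; apply: eq_bexp_on => e e' ee' _ _.
  by rewrite (dQ _ _ ee').
by rewrite /edge_prob /=; ring.
Qed.

End BranchStep.

Arguments at_children {A} Q e.

Section ZeroOne.
Context {R : realType} (A : finType) (p : A -> R) (d : measure_display)
  (T : measurableType d) (P : probability T R) (X : seq A * A -> set T).
Hypothesis p01 : forall c, 0 <= p c <= 1.
Hypothesis p_gt1 : 1 < \sum_c p c.
Hypothesis mX : forall i, measurable (X i).
Hypothesis PX : forall i, P (X i) = (edge_prob p i)%:E.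
Hypothesis indX : mutually_independent P X.
Notation conf := (seq A * A -> bool).
Local Notation pr Q := (fine (P [set t | Q (config X t)])).
Implicit Types (Q : conf -> bool).

Lemma prob_below n Q : depends_on (coords_below A n) Q ->
  pr Q = bexp (edge_prob p) (coords_below A n) (fun e => (Q e)%:R) (fun=> false).
Proof. by move=> dQ; apply: prob_config => //; exact: coords_below_uniq. Qed.

(** The subtrees of the children of the root are independent and distributed as
    the whole tree. *)
Lemma prob_at_children n Q : depends_on (coords_below A n) Q ->
  pr (at_children Q) = 1 - surv p (1 - pr Q).
Proof.
move=> dQ; rewrite (prob_below dQ) /surv subKr -bexp_at_children //.
apply: prob_config => //; first exact: child_coords_uniq.
move=> e e' ee'; apply: eq_forallb => c; apply: (depends_on_child dQ) => i ic.
by apply: ee'; apply/flatten_mapP; exists c => //; rewrite mem_index_enum.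
Qed.

Lemma prob_iter_at_children n m Q : depends_on (coords_below A n) Q ->
  pr (iter m at_children Q) = 1 - iter m (surv p) (1 - pr Q).
Proof.
move=> dQ; elim: m => [|m IH] /=; first by rewrite subKr.
by rewrite (prob_at_children (depends_on_iter_at_children (m := m) dQ)) IH; congr (1 - surv p _); rewrite subKr.
Qed.

Variables (gam : R) (n : nat -> nat) (D : nat -> conf -> bool).
Hypothesis gam0 : 0 < gam.
Hypothesis dD : forall j, depends_on (coords_below A (n j)) (D j).
Hypothesis D_dec : forall j e, D j.+1 e -> D j e.
Hypothesis D_gam : forall j, gam <= pr (D j).

(** Almost surely on survival, some kept node sees the event [forall j, D j]
    realized in its subtree. *)
Lemma zero_one : P.-negligible [set t |
  (forall m, exists2 w, size w = m & kept (config X t) w) /\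
  ~ exists2 v, kept (config X t) v & forall j, D j (subconf v (config X t))].
Proof.
have [g0 /andP[g00 g01] Hg0] := surv_ge p01 p_gt1.
(* At [g] the map [surv p] exceeds the identity. *)
pose g := Num.min gam g0.
have gg : 0 < g <= 1.
  by rewrite lt_min gam0 g00 /= ge_min g01 orbT.
have [gpos g1] : 0 < g /\ g <= 1 by case/andP: gg.
have gs : g <= surv p g by apply: Hg0; rewrite (ltW gpos) ge_min lexx orbT.
have [c /andP[c0 c1] Hc] := iter_surv_close p01 p_gt1 gg gs.
(* [dead m]: generation [m] is empty; [bad m j]: no kept node of generation [m]
   sees [D j] in its subtree. *)
pose dead m e := iter m (@at_children A) (fun=> false) e.
pose bad m j e := iter m (@at_children A) (fun e => ~~ D j e) e.
have dbad m j : depends_on (coords_below A (m + n j)) (bad m j).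
  by apply: depends_on_iter_at_children => e e' ee'; rewrite (dD ee').
have ddead m : depends_on (coords_below A (m + 0)) (dead m).
  exact: depends_on_iter_at_children.
have mconf k Q : depends_on (coords_below A k) Q ->
    measurable [set t | Q (config X t)] by exact: measurable_config.
pose F m j := [set t | bad m j (config X t)] `&` ~` [set t | dead m (config X t)].
have mF m j : measurable (F m j).
  apply: measurableI; first exact: mconf _ _ (dbad m j).
  exact/measurableC/(mconf _ _ (ddead m)).
have FE m j : (P (F m j) <= ((1 - c) ^+ m)%:E)%E.
  have mb := mconf _ _ (dbad m j); have md := mconf _ _ (ddead m).
  rewrite -[leLHS]fineK ?fin_num_measure // lee_fin /F prIC //.
  rewrite (_ : _ `&` _ = [set t | dead m (config X t)]); last first.
    apply/seteqP; split=> t /= => [[]//|dt]; split => //.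
    apply/iter_at_childrenP => w wm kw.
    by have /iter_at_childrenP/(_ w wm kw) := dt.
  have dnD : depends_on (coords_below A (n j)) (fun e => ~~ D j e).
    by move=> e e' ee'; rewrite (dD ee').
  rewrite (prob_iter_at_children m dnD).
  rewrite (@prob_iter_at_children 0 m (fun=> false)) //.
  have -> : [set t : T | false] = set0 by apply/seteqP; split.
  rewrite measure0 subr0.
  have -> : 1 - pr (fun e => ~~ D j e) = pr (D j).
    have -> : [set t | ~~ D j (config X t)] = setT `&` ~` [set t | D j (config X t)].
      by rewrite setTI; apply/seteqP; split => t /= /negP.
    have mDj := mconf _ _ (@dD j).
    by rewrite prIC // setTI probability_setT subKr.
  have pD1 : pr (D j) <= 1.
    by rewrite -lee_fin fineK ?fin_num_measure ?probability_le1 //; exact: mconf _ _ (@dD j).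
  have gD : g <= pr (D j) by apply: le_trans (D_gam j); rewrite ge_min lexx.
  have := le_iter_surv p01 m (ltW gpos) gD pD1; have := Hc m.
  by lra.
have Fmono m : nondecreasing_seq (F m).
  apply/nondecreasing_seqP => j; apply/subsetPset => t [/= bt nd]; split => //.
  apply/iter_at_childrenP => w wm kw.
  have /iter_at_childrenP/(_ w wm kw) := bt; apply: contra; exact: D_dec.
have FP m : (P (\bigcup_j F m j) <= ((1 - c) ^+ m)%:E)%E.
  have mU : measurable (\bigcup_j F m j) by apply: bigcupT_measurable.
  have cv := nondecreasing_cvg_mu (mF m) mU (Fmono m) (mu := P).
  by apply: (cvge_le _ cv); near=> j; exact: FE.
exists (\bigcap_m \bigcup_j F m j).
have mFF : measurable (\bigcap_m \bigcup_j F m j).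
  by apply: bigcapT_measurable => m; apply: bigcupT_measurable.
split => //.
  have le m : (P (\bigcap_m \bigcup_j F m j) <= ((1 - c) ^+ m)%:E)%E.
    apply: le_trans (FP m); apply: le_measure; rewrite ?inE //.
      by apply: bigcupT_measurable.
    exact: bigcap_inf.
  apply/eqP; rewrite -measure_le0; apply/lee_addgt0Pr => eps eps0; rewrite add0e.
  have [k Hk] : exists k, (1 - c) ^+ k <= eps by apply: expr_small => //; lra.
  by apply: (le_trans (le k)); rewrite lee_fin.
move=> t [/= alive nogood] m _.
set e := config X t in alive nogood.
have : exists j, forall w, w \in words A m -> kept e w -> ~~ D j (subconf w e).
  elim: (words A m) => [|w l [j Hj]]; first by exists 0%N.
  have Dle i k e' : D (i + k)%N e' -> D i e'.
    by elim: k => [|k IH]; [rewrite addn0|rewrite addnS => /D_dec].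
  have [i Hi] : exists i, kept e w -> ~~ D i (subconf w e).
    apply: contrapT => H; apply: nogood; exists w.
      apply: contrapT => kw; apply: H; exists 0%N => /kw //.
    by move=> i; apply: contrapT => /negP Di; apply: H; exists i.
  exists (i + j)%N => v; rewrite inE => /orP[/eqP ->|vl] kv.
    by apply: contra (Hi kv); exact: Dle.
  by apply: contra (Hj v vl kv); rewrite addnC; exact: Dle.
move=> [j Hj]; exists j => //; split => /=.
  by apply/iter_at_childrenP => w wm kw; apply: Hj => //; rewrite mem_words wm.
have [w wm kw] := alive m.
by move=> /iter_at_childrenP/(_ w wm kw).
Unshelve. all: by end_near.
Qed.

End ZeroOne.

(** * Projection onto the diagonal *)

Lemma tuple_rcons_exists M n (w : n.+1.-tuple (cell M)) :
  exists (v : n.-tuple (cell M)) c, w = [tuple of rcons v c].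
Proof.
case: w => s; case: (lastP s) => [//|v c] sz.
have vn : size v == n by rewrite size_rcons eqSS in sz.
by exists (Tuple vn), c; apply/val_inj.
Qed.

Section DiagonalCoordinate.
Context {R : realType} (M : nat) (alpha : R).
Hypothesis M0 : (0 < M)%N.
Hypothesis dirs : directions alpha.
Implicit Types (z q : R * R) (c : cell M).

(** The fibre through [z] meets the line of the diagonal at the parameter
    [(z.1 * cos alpha + z.2 * sin alpha) / slope + intercept]. *)
Definition slope : R :=
  if alpha < pi / 2 then cos alpha + sin alpha else cos alpha - sin alpha.

Definition intercept : R := if alpha < pi / 2 then 0 else - sin alpha / slope.

(** The parameter on the diagonal of the point lying on the fibre through [z]. *)
Definition dcoord z : R := (z.1 * cos alpha + z.2 * sin alpha) / slope + intercept.

(** The position of [x] relative to the cell [c] is [M%:R * x - offset c]; as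
    [dcoord] is affine, [M%:R - 1] copies of its constant term have to be
    removed. *)
Definition offset c : R :=
  (c.1%:R * cos alpha + c.2%:R * sin alpha) / slope + (M%:R - 1) * intercept.

Lemma slope_neq0 : slope != 0.
Proof.
have [s0] := directions_cossin dirs; rewrite /slope.
by case: ifP => _ c0; [rewrite gt_eqF|rewrite lt_eqF]; lra.
Qed.

Lemma M_gt0 : 0 < M%:R :> R. Proof. by rewrite ltr0n. Qed.
Lemma M_neq0 : M%:R != 0 :> R. Proof. by rewrite gt_eqF ?M_gt0. Qed.

Lemma dcoord_diag_point t : dcoord (diag_point alpha t) = t.
Proof.
have := slope_neq0; rewrite /dcoord /intercept /slope /diag_point /=.
by case: ifP => _ s0; field.
Qed.

Lemma dcoord_eqP z z' : dcoord z = dcoord z' <-> orth_proj alpha z = orth_proj alpha z'.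
Proof.
rewrite proj_eqE /dcoord; split=> [/addIr/(mulIf _) -> //|->//].
by rewrite invr_eq0 slope_neq0.
Qed.

Lemma diag_projE z : unit_square z ->
  diag_proj alpha z = diag_point alpha (dcoord z).
Proof.
move=> /(diag_projP dirs)[[t _ <-]] /dcoord_eqP.
by rewrite dcoord_diag_point => ->.
Qed.

Lemma dcoord_itv z : unit_square z -> 0 <= dcoord z <= 1.
Proof.
move=> /(diag_projP dirs)[[t /= t01 <-]] /dcoord_eqP.
by rewrite dcoord_diag_point => <-.
Qed.

Lemma dcoord_zoom c z :
  M%:R * dcoord z - offset c = dcoord (M%:R * z.1 - c.1%:R, M%:R * z.2 - c.2%:R).
Proof. by rewrite /offset /dcoord /=; have := slope_neq0 => s0; field. Qed.

Lemma digit_sum_cons (g : cell M -> R) n c (w : n.-tuple (cell M)) :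
  M%:R * (\sum_(l < n.+1) g (tnth [tuple of c :: w] l) / M%:R ^+ l.+1) =
  g c + \sum_(l < n) g (tnth w l) / M%:R ^+ l.+1.
Proof.
have m0 := M_neq0; rewrite big_ord_recl tnth0 /= expr1 mulrDr mulrCA divff ?mulr1 //.
congr (_ + _); rewrite mulr_sumr; apply: eq_bigr => l _.
by rewrite tnthS /bump /= exprS invfM mulrCA mulVKf // mulrC mulrA mulrCA mulrA divff ?mul1r.
Qed.

(** [pos w] inverts the projection of the similarity that maps the unit square
    onto the cell of [w]. *)
Lemma pos_corner n (w : n.-tuple (cell M)) q :
  pos M offset w (dcoord ((corner w).1 + M%:R ^- n * q.1,
                          (corner w).2 + M%:R ^- n * q.2)) = dcoord q.
Proof.
have m0 := M_neq0.
elim: n w => [|n IH] w.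
  rewrite tuple0 /= /corner !big_ord0 /= expr0 invr1 !mul1r !add0r.
  by case: q.
case/tupleP: w => c w; rewrite /= dcoord_zoom /= -(IH w); congr (pos _ _ _ (dcoord _)).
rewrite !mulrDr (digit_sum_cons (fun c => c.1%:R)) (digit_sum_cons (fun c => c.2%:R)).
by rewrite exprS invfM !mulrA divff // !mul1r; congr pair; rewrite /=; ring.
Qed.

Lemma pos_inj (w : seq (cell M)) : injective (pos M offset w : R -> R).
Proof.
move=> x y /eqP; rewrite -subr_eq0 pos_sub mulf_eq0 subr_eq0 => /orP[/eqP //|].
by rewrite pnatr_eq0 expn_eq0 -leqn0 leqNgt M0.
Qed.

(** Parameters whose position relative to [w] lies in the unit interval are in
    the projection of the cell of [w]. *)
Lemma square_dcoord n (w : n.-tuple (cell M)) x : 0 <= pos M offset w x <= 1 ->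
  exists2 z, square w z & dcoord z = x.
Proof.
set t := pos _ _ _ _ => /andP[t0 t1].
pose q := diag_point alpha t.
exists ((corner w).1 + M%:R ^- n * q.1, (corner w).2 + M%:R ^- n * q.2); last first.
  by apply: (@pos_inj w); rewrite pos_corner dcoord_diag_point.
have h : 0 < M%:R ^- n :> R by rewrite invr_gt0 exprn_gt0 // M_gt0.
have [h1 h2] : 0 <= q.2 /\ q.2 <= 1 by rewrite /q /=; case: ifP => _; lra.
split; rewrite /= in_itv /= lerDl lerD2l.
  by rewrite mulr_ge0 ?(ltW h) //= ler_piMr // ltW.
by rewrite mulr_ge0 ?(ltW h) //= ler_piMr // ltW.
Qed.

Lemma square_rcons n (w : n.-tuple (cell M)) c :
  (square [tuple of rcons w c] : set (R * R)) `<=` square w.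
Proof.
have m0 := M_neq0; have mp := M_gt0.
have E (g : cell M -> R) : \sum_(l < n.+1) g (tnth [tuple of rcons w c] l) / M%:R ^+ l.+1 =
    \sum_(l < n) g (tnth w l) / M%:R ^+ l.+1 + g c / M%:R ^+ n.+1.
  rewrite big_ord_recr /=; congr (_ + _ / _).
    apply: eq_bigr => l _; congr (g _ / _).
    by rewrite !(tnth_nth c) /= nth_rcons size_tuple ltn_ord.
  by rewrite (tnth_nth c) /= nth_rcons size_tuple ltnn eqxx.
have step (k : 'I_M) : 0 <= k%:R / M%:R ^+ n.+1 :> R /\
    k%:R / M%:R ^+ n.+1 + M%:R ^- n.+1 <= M%:R ^- n :> R.
  split; first by rewrite divr_ge0 // exprn_ge0 // ltW.
  rewrite -[X in _ + X]mul1r -mulrDl ler_pdivrMr ?exprn_gt0 // exprS.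
  by rewrite mulrCA mulVf ?mulr1 ?expf_neq0 // natr1 ler_nat.
move=> z []; rewrite /= !in_itv /=.
rewrite (E (fun c => c.1%:R)) (E (fun c => c.2%:R)).
have [] := step c.1; have [] := step c.2.
by move=> a1 a2 b1 b2 /andP[? ?] /andP[? ?]; split; rewrite /= in_itv /=; apply/andP; split; lra.
Qed.

Lemma square_nil : @square R M 0 [tuple] = unit_square.
Proof. by rewrite /square /corner /unit_square !big_ord0 /= expr0 invr1 add0r. Qed.

Lemma square_sub_unit n (w : n.-tuple (cell M)) :
  (square w : set (R * R)) `<=` unit_square.
Proof.
elim: n w => [|n IH] w; first by rewrite tuple0 square_nil.
have [v [c ->]] := tuple_rcons_exists w.
exact: subset_trans (@square_rcons n v c) (IH v).
Qed.

Lemma closed_square n (w : n.-tuple (cell M)) : closed (square w : set (R * R)).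
Proof.
rewrite /square.
rewrite (_ : _ `*` _ = fst @^-1` `[(corner w).1, (corner w).1 + M%:R ^- n] `&`
  snd @^-1` `[(corner w).2, (corner w).2 + M%:R ^- n]) //.
apply: closedI; apply: preimage_closed; try exact: itv_closed.
  by move=> z _; exact: cvg_fst.
by move=> z _; exact: cvg_snd.
Qed.

Lemma dcoord_continuous : continuous (dcoord : R * R -> R).
Proof.
move=> z; rewrite /dcoord; apply: cvgD; last exact: cvg_cst.
apply: cvgMl; apply: cvgD; apply: cvgMl; [exact: cvg_fst|exact: cvg_snd].
Qed.

Lemma phiE c z : phi c z = ((corner [tuple c]).1 + M%:R ^- 1 * z.1,
                            (corner [tuple c]).2 + M%:R ^- 1 * z.2) :> R * R.
Proof.
rewrite /phi /corner !big_ord1 /= !expr1 !(tnth_nth c) /=.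
by congr pair; rewrite addrC; congr (_ + _); rewrite mulrC.
Qed.

Lemma dcoord_phi c z : M%:R * dcoord (phi c z) - offset c = dcoord z.
Proof. by have := pos_corner [tuple c] z; rewrite -phiE. Qed.

Lemma unit_square_diag t : 0 <= t <= 1 -> unit_square (diag_point alpha t).
Proof.
move=> /andP[t0 t1]; split; rewrite /= in_itv /= ?t0 //.
by case: ifP => _; apply/andP; split; lra.
Qed.

Lemma square_phi c z : unit_square z -> square [tuple c] (phi c z).
Proof.
rewrite phiE => -[]; rewrite /= !in_itv /= => /andP[a0 a1] /andP[b0 b1].
have h : 0 < M%:R ^- 1 :> R by rewrite invr_gt0 exprn_gt0 // M_gt0.
split; rewrite /= in_itv /= lerDl lerD2l.
  by rewrite mulr_ge0 ?(ltW h) //= ler_piMr // ltW.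
by rewrite mulr_ge0 ?(ltW h) //= ler_piMr // ltW.
Qed.

Lemma phi_onto c z : square [tuple c] z -> exists2 q, unit_square q & phi c q = z.
Proof.
have mp := M_gt0; have m0 := M_neq0.
exists (M%:R * (z.1 - (corner [tuple c]).1), M%:R * (z.2 - (corner [tuple c]).2)).
  case: H => /=; rewrite !in_itv /= expr1 => /andP[h1 h2] /andP[h3 h4].
  have H (x y : R) : x <= y -> y <= x + M%:R^-1 -> 0 <= M%:R * (y - x) <= 1.
    move=> xy yx; rewrite mulr_ge0 ?subr_ge0 ?(ltW mp) //= mulrC -ler_pdivlMr // mul1r.
    by rewrite lerBlDl.
  by split; rewrite /= in_itv /=; apply: H.
by rewrite phiE /= expr1 !mulKf // !subrKC; case: (z).
Qed.

Lemma unit_phi c z : unit_square z -> unit_square (phi c z).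
Proof. by move=> /(@square_phi c); exact: square_sub_unit. Qed.

(** The projection of a cell is contained in the diagonal. *)
Lemma child_itv c t : 0 <= M%:R * t - offset c <= 1 -> 0 <= t <= 1.
Proof.
move=> /(@square_dcoord 1 [tuple c])[z /square_sub_unit zu <-].
exact: dcoord_itv.
Qed.

Lemma diag_proj_square c t :
  (diag_point alpha t \in diag_proj alpha @` square [tuple c]) =
  (0 <= M%:R * t - offset c <= 1).
Proof.
apply/idP/idP => [|h].
  rewrite inE => -[z zc]; have zu := square_sub_unit zc.
  rewrite diag_projE // => /diag_point_inj <-.
  have [q qu <-] := phi_onto zc.
  by rewrite dcoord_phi; exact: dcoord_itv.
have [z zc zt] := @square_dcoord 1 [tuple c] t h.
rewrite inE; exists z => //; rewrite diag_projE ?zt //; exact: square_sub_unit zc.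
Qed.

Lemma psi_diag_point c t : 0 <= M%:R * t - offset c <= 1 ->
  psi alpha c (diag_point alpha t) = diag_point alpha (M%:R * t - offset c).
Proof.
move=> h; have m0 := M_neq0.
have E u : 0 <= u <= 1 -> (diag_proj alpha \o phi c) (diag_point alpha u) =
    diag_point alpha ((u + offset c) / M%:R).
  move=> u01 /=; rewrite diag_projE; last exact/unit_phi/unit_square_diag.
  congr diag_point; apply: (mulfI m0); rewrite [RHS]mulrCA divff // mulr1.
  by apply/eqP; rewrite -subr_eq dcoord_phi dcoord_diag_point.
rewrite /psi.
have -> : diag_point alpha t =
    (diag_proj alpha \o phi c) (diag_point alpha (M%:R * t - offset c)).
  by rewrite E // subrK mulrC mulKf.
apply: pinvKV; last by rewrite inE; exists (M%:R * t - offset c).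
move=> x y; rewrite !inE => -[u u01 <-] [v v01 <-].
rewrite !E // => /diag_point_inj /(mulIf _) H; congr diag_point.
by apply: (addIr (offset c)); apply: H; rewrite invr_eq0.
Qed.

Variable p : 'I_M -> 'I_M -> R.
Notation weight := (fun c : cell M => p c.1 c.2).

Lemma F_op_diag_point (f : R * R -> R) (g : R -> R) t :
  (forall t, 0 <= t <= 1 -> f (diag_point alpha t) = g t) ->
  (forall t, ~~ (0 <= t <= 1) -> g t = 0) ->
  F_op p alpha f (diag_point alpha t) = transfer weight M offset g t.
Proof.
move=> fg g0; rewrite /F_op /transfer big_mkcond; apply: eq_bigr => c _.
rewrite diag_proj_square; case: ifPn => h; last by rewrite g0 // mulr0.
by rewrite psi_diag_point // fg.
Qed.

Lemma iter_F_op_diag_point n (f : R * R -> R) (g : R -> R) :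
  (forall t, 0 <= t <= 1 -> f (diag_point alpha t) = g t) ->
  (forall t, ~~ (0 <= t <= 1) -> g t = 0) ->
  (forall t, 0 <= t <= 1 ->
     iter n (F_op p alpha) f (diag_point alpha t) =
     iter n (transfer weight M offset) g t) /\
  (forall t, ~~ (0 <= t <= 1) -> iter n (transfer weight M offset) g t = 0).
Proof.
move=> fg g0; elim: n => [//|n [IH1 IH2]]; split=> t t01 /=.
  exact: F_op_diag_point.
rewrite /transfer big1 // => c _; rewrite IH2 ?mulr0 //.
by apply: contra t01; exact: child_itv.
Qed.

Lemma conditionA_transfer : conditionA p alpha -> exists (a1 b1 a2 b2 : R) (r : nat),
  [/\ a2 < a1, a1 < b1 & b1 < b2] /\ [/\ 0 < a2, b2 < 1, (0 < r)%N &
  forall x, between a2 b2 x ->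
    2 <= iter r (transfer weight M offset) (fun x => (between a1 b1 x)%:R) x].
Proof.
move=> [_ [_ [r [[[a1 [b1 [a10 ab1 b11 ->]]] [a2 [b2 [a20 ab2 b21 ->]]] r0]]]]].
rewrite !diag_interior_itv => -[I12 I2 H].
have sub (x y x' y' : R) : x < y -> diag_point alpha @` `[x, y] `<=`
    diag_point alpha @` `]x', y'[ -> x' < x /\ y < y'.
  move=> xy S.
  have [u] : (diag_point alpha @` `]x', y'[) (diag_point alpha x).
    by apply: S; exists x => //=; rewrite in_itv /= lexx ltW.
  move=> /= + /diag_point_inj ux; rewrite ux in_itv /= => /andP[-> _].
  have [v] : (diag_point alpha @` `]x', y'[) (diag_point alpha y).
    by apply: S; exists y => //=; rewrite in_itv /= lexx ltW.
  by move=> /= + /diag_point_inj vy; rewrite vy in_itv /= => /andP[_ ->].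
have [a21 b12] := sub _ _ _ _ ab1 I12.
have [a20' b21'] := sub _ _ _ _ ab2 I2.
exists a1, b1, a2, b2, r; split; split => // x x2.
have indic (a b t : R) :
    \1_(diag_point alpha @` `[a, b]) (diag_point alpha t) = (between a b t)%:R :> R.
  rewrite indicE; congr (nat_of_bool _)%:R; apply/idP/idP.
    by rewrite inE => -[s /= sab /diag_point_inj <-]; rewrite in_itv in sab.
  by move=> tab; rewrite inE; exists t => //=; rewrite in_itv.
have x01 : 0 <= x <= 1.
  by case/andP: x2 => *; apply/andP; split; lra.
have out t : ~~ (0 <= t <= 1) -> (between a1 b1 t)%:R = 0 :> R.
  move=> t01; case: (boolP (between a1 b1 t)) => // /andP[h1 h2].
  by case/negP: t01; apply/andP; split; lra.
have [<- // _] := iter_F_op_diag_point r (fun t _ => indic a1 b1 t) out.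
have := H (diag_point alpha x); rewrite indic x2 mulr1; apply.
by exists x.
Qed.

End DiagonalCoordinate.

(** * Points of the limit set *)

Section LimitSet.
Context {R : realType} (M : nat) (T : Type) (X : seq (cell M) * cell M -> set T).
Hypothesis M0 : (0 < M)%N.
Variable t : T.
Notation e := (config X t).

Lemma survivingP n (w : n.-tuple (cell M)) : surviving X t w <-> kept e w.
Proof.
elim: n w => [|n IH] w; first by split=> // _; rewrite /= tuple0.
split=> [[v [c [/IH kv Xvc ->]]]|].
  by rewrite /= kept_rcons kv; apply/asboolP.
have [v [c ->]] := tuple_rcons_exists w; rewrite /= kept_rcons => /andP[kv ec].
exists v, c; split => //; first exact/IH.
by move/asboolP: ec.
Qed.

Lemma percolation_levelS n :
  (percolation_level X t n.+1 : set (R * R)) `<=` percolation_level X t n.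
Proof.
move=> z [w [v [c [sv _ ->]]] wz]; exists v => //.
exact: square_rcons wz.
Qed.

Lemma percolation_level_anti m n : (m <= n)%N ->
  (percolation_level X t n : set (R * R)) `<=` percolation_level X t m.
Proof.
move=> /subnKC <-; elim: (n - m)%N => [|k IH]; first by rewrite addn0.
by rewrite addnS; exact: subset_trans (@percolation_levelS _) IH.
Qed.

Lemma closed_percolation_level n : closed (percolation_level X t n : set (R * R)).
Proof.
apply: closed_bigcup => [|w _]; first exact: finite_finset.
exact: closed_square.
Qed.

Lemma kept_of_limit : fractal_percolation R X t !=set0 ->
  forall m, exists2 w, size w = m & kept e w.
Proof.
move=> [z Ez] [|m]; first by exists [::].
have [w sw _] := Ez m.+1 isT.
by exists w; [rewrite size_tuple|exact/survivingP].
Qed.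

Variable alpha : R.
Hypothesis dirs : directions alpha.

(** Compactness: a parameter in the projection of kept cells of arbitrarily high
    generation is in the projection of the limit set. *)
Lemma limit_of_kept (x : R) :
  (forall m, exists w, [/\ (m <= size w)%N, kept e w &
     0 <= pos M (offset alpha) w x <= 1]) ->
  exists2 z, fractal_percolation R X t z & dcoord alpha z = x.
Proof.
move=> H.
have /choice[z Hz] : forall m, exists z : R * R,
    percolation_level X t m z /\ dcoord alpha z = x.
  move=> m; have [w [mw kw w01]] := H m.
  have [z zw zx] := square_dcoord M0 dirs (w := in_tuple w) w01.
  exists z; split => //; apply: (percolation_level_anti mw).
  by exists (in_tuple w) => //; exact/survivingP.
have zE m n : (m <= n)%N -> percolation_level X t m (z n).
  by move=> mn; apply: (percolation_level_anti mn); case: (Hz n).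
have cpt : compact (@unit_square R) by apply: compact_setX; exact: segment_compact.
have [|y [_ ycl]] := cpt (z @ \oo) _.
  exists 0%N => // n _; have [w _] := proj1 (Hz n).
  exact: (square_sub_unit M0).
(* [y] is a cluster point of the sequence [z]. *)
have yin (B : set (R * R)) : closed B -> (\forall n \near \oo, B (z n)) -> B y.
  by move=> cB nB; apply: cB; move: ycl; rewrite clusterE; apply.
exists y.
  move=> m _; apply: yin; first exact: closed_percolation_level.
  by exists m => // n; exact: zE.
apply: (yin [set y | dcoord alpha y = x]).
  rewrite (_ : [set y | _] = dcoord alpha @^-1` [set x]) //.
  apply: preimage_closed; last exact: closed_eq.
  by move=> ? _; exact: dcoord_continuous.
by exists 0%N => // n _; case: (Hz n).
Qed.

(** If the kept descendants of one kept node cover an interval of relative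
    positions, then the projection of the limit set contains an interval. *)
Lemma contains_interval_of_kept (a b : R) v : 0 < a -> a < b -> b < 1 -> kept e v ->
  (forall x m, between a b x -> exists u, [/\ (m <= size u)%N, kept (subconf v e) u &
     between a b (pos M (offset alpha) u x)]) ->
  contains_interval alpha (orth_proj alpha @` fractal_percolation R X t).
Proof.
move=> a0 ab b1 kv H.
pose k := (M ^ size v)%:R / slope alpha; pose l := pos M (offset alpha) v (intercept alpha).
have k0 : k != 0.
  by rewrite mulf_neq0 ?invr_eq0 ?slope_neq0 // pnatr_eq0 -lt0n expn_gt0 M0.
have posE s : pos M (offset alpha) v (s / slope alpha + intercept alpha) = k * s + l.
  apply/eqP; rewrite -subr_eq /l pos_sub addrK /k; apply/eqP; ring.
have hit s : between a b (k * s + l) ->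
    (orth_proj alpha @` fractal_percolation R X t) (line_point alpha s).
  rewrite -posE => sab.
  have [m|z Ez zs] := @limit_of_kept (s / slope alpha + intercept alpha).
    have [u [mu ku /andP[u1 u2]]] := H _ m sab.
    exists (v ++ u); split; first by rewrite size_cat (leq_trans mu) // leq_addl.
      by rewrite kept_cat kv.
    by rewrite pos_cat; apply/andP; split; lra.
  exists z => //; rewrite /orth_proj; congr line_point.
  move: zs; rewrite /dcoord => /addIr/mulIf; apply.
  by rewrite invr_eq0 slope_neq0.
have [kp|kn] : 0 < k \/ k < 0 by apply/orP; rewrite orbC -neq_lt.
  exists ((a - l) / k), ((b - l) / k); split.
    by rewrite ltr_pM2r ?invr_gt0 // ltrD2r.
  move=> _ [s /= + <-]; rewrite in_itv /= ltr_pdivrMr // ltr_pdivlMr // => /andP[s1 s2].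
  by apply: hit; apply/andP; split; lra.
exists ((b - l) / k), ((a - l) / k); split.
  by rewrite ltr_nM2r ?invr_lt0 // ltrD2r.
move=> _ [s /= + <-]; rewrite in_itv /= ltr_ndivrMr // ltr_ndivlMr // => /andP[s1 s2].
by apply: hit; apply/andP; split; lra.
Qed.

End LimitSet.

Theorem theorem2 (R : realType) (d : measure_display) (T : measurableType d)
    (P : probability T R) (M : nat) (p : 'I_M -> 'I_M -> R)
    (X : seq (cell M) * cell M -> set T) (alpha : R) :
  (2 <= M)%N ->
  (forall i j, 0 <= p i j <= 1) ->
  M%:R < \sum_(i < M) \sum_(j < M) p i j ->
  percolation_choices P p X ->
  directions alpha ->
  conditionA p alpha ->
  {ae P, forall t, fractal_percolation R X t !=set0 ->
    contains_interval alpha (orth_proj alpha @` fractal_percolation R X t)}.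
Proof.
move=> M2 p01 pM [mX PX indX] dirs cA.
have M0 : (0 < M)%N by exact: ltn_trans M2.
pose q (c : cell M) := p c.1 c.2.
have q01 c : 0 <= q c <= 1 by exact: p01.
have q_gt1 : 1 < \sum_c q c.
  rewrite /q -(pair_bigA _ (fun i j => p i j)) /=; apply: le_lt_trans pM.
  by rewrite ler1n.
have PX' i : P (X i) = (edge_prob q i)%:E by case: i => w c; exact: PX.
have [a1 [b1 [a2 [b2 [r [[a21 ab1 b12] [a20 b21 r0 growth]]]]]]] :=
  conditionA_transfer M0 dirs cA.
have [gam [n [D [gam0 dD D_dec D_gam good]]]] :=
  good_event q01 M0 a21 ab1 b12 growth r0.
have D_gam' j : gam <= fine (P [set t | D j (config X t)]).
  by rewrite (prob_below mX PX' indX (dD j)).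
apply: negligibleS (zero_one q01 q_gt1 mX PX' indX gam0 dD D_dec D_gam').
move=> t /= /not_implyP[Et noint]; split; first exact: kept_of_limit Et.
move=> [v kv Dv]; apply: noint.
apply: (contains_interval_of_kept M0 dirs a20 _ b21 kv (good _ Dv)).
exact: lt_trans (lt_trans a21 ab1) b12.
Qed.
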